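(* Let $\alpha\in(0,1)$, $\alpha+\gamma>0$, $a,b>0$, and set $\eta_1:=\frac a2-\sqrt{\frac{a^2}{4}-b}$, $\eta_2:=\frac a2+\sqrt{\frac{a^2}4-b}$. Consider solutions of $$\big(\mathcal{D}^{(\alpha,\gamma)}_t\big)^2f(t)+a\,\mathcal{D}^{(\alpha,\gamma)}_tf(t)+b f(t)=0,\qquad t>0,$$ of the form $f(t)=\sum_{n\ge0}f_nt^{(\alpha+\gamma)n}$. If $b\ne a^2/4$, every such solution is $$f(t)=K_1\operatorname{E}_{\alpha,1+\gamma/\alpha,\gamma/\alpha}(-\eta_1t^{\alpha+\gamma})+K_2\operatorname{E}_{\alpha,1+\gamma/\alpha,\gamma/\alpha}(-\eta_2t^{\alpha+\gamma}),$$ with $K_1,K_2$ real if $a^2/4>b$, and complex with $K_1=\overline{K_2}$ if $a^2/4<b$ (for real $f$). If $b=a^2/4$, every such solution is $$f(t)=K_1'\operatorname{E}_{\alpha,1+\gamma/\alpha,\gamma/\alpha}(-(a/2)t^{\alpha+\gamma})+K_2'\,t^{\alpha+\gamma}\operatorname{E}^{(1)}_{\alpha,1+\gamma/\alpha,\gamma/\alpha}(-(a/2)t^{\alpha+\gamma}),$$ with $K_1',K_2'$ real constants.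
   Context: Caputo derivative for $0<\alpha<1$ and absolutely continuous $f$: ${}^C\!D^{(\alpha)}_tf(t)=\frac1{\Gamma(1-\alpha)}\int_0^t\frac{f'(\tau)}{(t-\tau)^\alpha}d\tau$. Stretched operator: $\mathcal{D}^{(\alpha,\gamma)}_t:=t^{-\gamma}\,{}^C\!D^{(\alpha)}_t$; $(\mathcal{D}^{(\alpha,\gamma)}_t)^2$ denotes its sequential (two-fold) application. In particular $\mathcal{D}^{(\alpha,\gamma)}_tt^\beta=\frac{\Gamma(\beta+1)}{\Gamma(\beta-\alpha+1)}t^{\beta-\alpha-\gamma}$ for $\beta\neq0$ and $\mathcal{D}^{(\alpha,\gamma)}_t1=0$. Kilbas–Saigo function: $\operatorname{E}_{a,m,l}(z)=1+\sum_{n\ge1}\prod_{k=1}^n\frac{\Gamma(1+a((k-1)m+l))}{\Gamma(1+a((k-1)m+l+1))}z^n$; $\operatorname{E}^{(1)}_{a,m,l}$ is its first derivative. *)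

(* Defs.v *)
From Stdlib Require Import Reals.
From Coquelicot Require Import Coquelicot.
Open Scope R_scope.

(** Euler Gamma function (used here only at positive arguments):
    Gamma x = \int_0^\infty t^(x-1) e^(-t) dt  (improper integral). *)
Definition Gamma (x : R) : R :=
  RInt_gen (fun t => Rpower t (x - 1) * exp (- t))
           (at_right 0) (Rbar_locally p_infty).

Definition caputo_at (alpha : R) (f : R -> R) (t v : R) : Prop :=
  (forall tau, 0 < tau < t -> ex_derive f tau) /\
  is_RInt_gen (fun tau => Derive f tau * Rpower (t - tau) (- alpha))
              (at_right 0) (at_left t) (Gamma (1 - alpha) * v).

(** Stretched operator  D^(alpha,gamma)_t = t^(-gamma) * Caputo D^(alpha)_t :
    [stretched_deriv alpha gamma f g] means that for every t > 0 the
    stretched derivative of f at t exists and equals g t. *)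
Definition stretched_deriv (alpha gamma : R) (f g : R -> R) : Prop :=
  forall t, 0 < t -> caputo_at alpha f t (Rpower t gamma * g t).

Fixpoint KS_coef (a m l : R) (n : nat) : R :=
  match n with
  | O => 1
  | S n' => KS_coef a m l n' *
            (Gamma (1 + a * (INR n' * m + l)) / Gamma (1 + a * (INR n' * m + l + 1)))
  end.

Definition KS_E (a m l : R) (z : R) : R := PSeries (KS_coef a m l) z.

Definition KS_E1 (a m l : R) (z : R) : R := Derive (KS_E a m l) z.

Definition KS_EC (a m l : R) (z : C) : C :=
  @lim C_CompleteNormedModule
    (filtermap (sum_n (fun n => Cmult (RtoC (KS_coef a m l n)) (pow_n z n)))
               eventually).

(* Main.v *)
Require Import Defs.
From Stdlib Require Import Reals Lra Lia.
From Coquelicot Require Import Coquelicot.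
Open Scope R_scope.

(** With [c = alpha + gamma], the solution is [f t = F (t^c)] for an entire power
    series [F].  The stretched operator maps [sum u_n t^(c n)] to
    [sum r_(n+1) u_(n+1) t^(c n)], [r_n = Gamma (1 + c n) / Gamma (1 + c n - alpha)]:
    integrate termwise against [(t - tau)^(-alpha)] and use the Beta integral
    [B(x, y) = Gamma x Gamma y / Gamma (x + y)].  The Kilbas-Saigo coefficients are
    [e_n = 1 / (r_1 ... r_n)], so [u_n = e_n v_n] turns the equation into
    [v_(n+2) + a v_(n+1) + b v_n = 0], whose solutions are combinations of powers
    of the roots of [z^2 + a z + b].  The resulting series can be split because
    [r_n] tends to infinity (a lower bound on the Beta integral), which makes the
    Kilbas-Saigo series entire. *)

(** * Improper integrals of nonnegative functions *)

(** [Gamma] and the Caputo derivative are improper Riemann integrals, so the Beta identity requires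
    exchanging two improper integrals. For nonnegative integrands an improper integral is a supremum
    over compact intervals: existence becomes a matter of upper bounds, substitution a matter of
    matching compact intervals, and the exchange reduces to rectangles. The derivatives [g1] and
    [g2] enter only as functions whose values are certain integrals; nothing says in advance that
    they are series. Their expansions are derived by comparing the given value of the integral with
    the integrals of the partial sums. Convergence for all positive [t] makes the given series
    entire at once. It does not give the same for the Kilbas-Saigo series: [v_n] may vanish
    identically, and then the convergence of [sum e_n v_n t^(c n)] says nothing about [e_n]. Hence
    the separate growth estimate for [r_n]. *)

Record open_interval (D : R -> Prop) : Prop := {
  oi_open : forall x, D x -> locally x D;
  oi_convex : forall x y z, D x -> D z -> x <= y <= z -> D y }.

(** [Fa] and [Fb] approach the two ends from inside [D], passing every given point. The half-line of
    the Gamma integral and the interval [(0, t)] of the Caputo integral thus share one theory. *)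
Record interval_ends (D : R -> Prop) (Fa Fb : (R -> Prop) -> Prop) : Prop := {
  ie_interval : open_interval D;
  ie_left : forall c, D c -> Fa (fun x => D x /\ x <= c);
  ie_right : forall c, D c -> Fb (fun x => D x /\ c <= x) }.

(** For [f >= 0] continuous on [D], this says that [v] is the improper integral. *)
Definition sup_integral (D : R -> Prop) (f : R -> R) (v : R) : Prop :=
  (forall a b, D a -> D b -> a <= b -> RInt f a b <= v) /\
  (forall eps, 0 < eps ->
     exists a b, D a /\ D b /\ a <= b /\ v - eps < RInt f a b).

Lemma positive_ends :
  interval_ends (fun x => 0 < x) (at_right 0) (Rbar_locally p_infty).
Proof.
split.
- split; [intros x; apply open_gt | intros x y z; lra].
- intros c Hc. exists (mkposreal c Hc). intros y Hy Hy0.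
  change (Rabs (y - 0) < c) in Hy. apply Rabs_def2 in Hy. lra.
- intros c Hc. exists c. intros; lra.
Qed.

Lemma bounded_ends (t : R) : 0 < t ->
  interval_ends (fun x => 0 < x < t) (at_right 0) (at_left t).
Proof.
intros Ht. split.
- split.
  + intros x [H1 H2]. apply filter_and; [now apply open_gt | now apply open_lt].
  + intros x y z; lra.
- intros c [Hc Hct]. exists (mkposreal c Hc). intros y Hy Hy0.
  change (Rabs (y - 0) < c) in Hy. apply Rabs_def2 in Hy. lra.
- intros c [Hc Hct]. assert (Hd : 0 < t - c) by lra.
  exists (mkposreal _ Hd). intros y Hy Hy0.
  change (Rabs (y - t) < t - c) in Hy.
  apply Rabs_def2 in Hy. lra.
Qed.

Lemma ex_RInt_interval D (f : R -> R) a b : open_interval D ->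
  (forall x, D x -> continuous f x) -> D a -> D b -> a <= b -> ex_RInt f a b.
Proof.
intros HD Hf Ha Hb Hab. apply (@ex_RInt_continuous R_CompleteNormedModule).
rewrite Rmin_left, Rmax_right by lra. intros z Hz. apply Hf.
now apply (oi_convex _ HD a z b).
Qed.

Lemma RInt_nonneg_incl D (f : R -> R) a b a' b' : open_interval D ->
  (forall x, D x -> continuous f x) -> (forall x, D x -> 0 <= f x) ->
  D a' -> D b' -> a' <= a -> a <= b -> b <= b' -> RInt f a b <= RInt f a' b'.
Proof.
intros HD Hc Hp Ha' Hb' H1 H2 H3.
assert (Da : D a) by (apply (oi_convex _ HD a' a b'); auto; lra).
assert (Db : D b) by (apply (oi_convex _ HD a' b b'); auto; lra).
assert (E : forall u v, D u -> D v -> u <= v -> ex_RInt f u v /\ 0 <= RInt f u v).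
{ intros u v Hu Hv Huv. assert (ex_RInt f u v) by now apply (ex_RInt_interval D).
  split; auto. apply RInt_ge_0; auto. intros x Hx. apply Hp.
  apply (oi_convex _ HD u x v); auto; lra. }
destruct (E a' a), (E a b), (E b b'); auto.
assert (E1 := RInt_Chasles f a' a b ltac:(auto) ltac:(auto)).
assert (E2 := RInt_Chasles f a' b b' (ex_RInt_Chasles f a' a b ltac:(auto) ltac:(auto)) ltac:(auto)).
unfold plus in E1, E2; simpl in E1, E2. lra.
Qed.

Lemma sup_integral_exists D (f : R -> R) M : open_interval D -> (exists c, D c) ->
  (forall a b, D a -> D b -> a <= b -> RInt f a b <= M) ->
  exists v, sup_integral D f v.
Proof.
intros HD [c Hc] HM.
destruct (completeness (fun y => exists a b, D a /\ D b /\ a <= b /\ y = RInt f a b))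
  as [v [Hv1 Hv2]].
- exists M. intros y (a & b & Ha & Hb & Hab & ->). now apply HM.
- exists (RInt f c c), c, c. repeat split; auto; lra.
- exists v. split.
  + intros a b Ha Hb Hab. apply Hv1. now exists a, b.
  + intros eps He. destruct (Classical_Prop.classic
      (exists a b, D a /\ D b /\ a <= b /\ v - eps < RInt f a b)) as [H|H]; auto.
    enough (v <= v - eps) by lra. apply Hv2.
    intros y (a & b & Ha & Hb & Hab & ->). apply Rnot_lt_le. intros Hl.
    apply H. now exists a, b.
Qed.

(** Monotonicity traps the integral over any interval containing a nearly optimal one between
    [v - eps] and [v]. *)
Lemma sup_integral_RInt_gen D Fa Fb f v : interval_ends D Fa Fb ->
  Filter Fa -> Filter Fb ->
  (forall x, D x -> continuous f x) -> (forall x, D x -> 0 <= f x) ->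
  sup_integral D f v -> is_RInt_gen f Fa Fb v.
Proof.
intros HD FFa FFb Hc Hp [Hv1 Hv2] P [eps HP].
destruct (Hv2 eps (cond_pos eps)) as (a & b & Ha & Hb & Hab & Hl).
exists (fun x => D x /\ x <= a) (fun x => D x /\ b <= x).
- now apply (ie_left _ _ _ HD).
- now apply (ie_right _ _ _ HD).
- intros x y [Hx Hxa] [Hy Hyb]. exists (RInt f x y). split.
  + apply (@RInt_correct R_CompleteNormedModule).
    apply (ex_RInt_interval D); auto; [apply HD | lra].
  + apply HP. change (Rabs (RInt f x y - v) < eps).
    assert (RInt f a b <= RInt f x y).
    { apply (RInt_nonneg_incl D); auto. apply HD. }
    assert (RInt f x y <= v) by (apply Hv1; auto; lra).
    apply Rabs_def1; lra.
Qed.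

Lemma sup_integral_ext D f g v : open_interval D ->
  (forall x, D x -> f x = g x) -> sup_integral D f v -> sup_integral D g v.
Proof.
intros HD He [H1 H2].
assert (E : forall a b, D a -> D b -> a <= b -> RInt f a b = RInt g a b).
{ intros a b Ha Hb Hab. apply RInt_ext. rewrite Rmin_left, Rmax_right by lra.
  intros x Hx. apply He. apply (oi_convex _ HD a x b); auto; lra. }
split.
- intros a b Ha Hb Hab. rewrite <- E; auto.
- intros eps Heps. destruct (H2 eps Heps) as (a & b & Ha & Hb & Hab & H).
  exists a, b. rewrite <- E; auto.
Qed.

Lemma sup_integral_scal D f k v : open_interval D ->
  (forall x, D x -> continuous f x) -> 0 < k ->
  sup_integral D f v -> sup_integral D (fun x => k * f x) (k * v).
Proof.
intros HD Hc Hk [H1 H2].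
assert (E : forall a b, D a -> D b -> a <= b ->
   RInt (fun x => k * f x) a b = k * RInt f a b).
{ intros a b Ha Hb Hab. apply (@RInt_scal R_CompleteNormedModule f a b k).
  now apply (ex_RInt_interval D). }
split.
- intros a b Ha Hb Hab. rewrite E; auto. apply Rmult_le_compat_l; auto; lra.
- intros eps Heps.
  destruct (H2 (eps / k) ltac:(now apply Rdiv_lt_0_compat)) as (a & b & Ha & Hb & Hab & H).
  exists a, b. repeat split; auto. rewrite E; auto.
  apply (Rmult_lt_compat_l k) in H; auto. replace (k * (v - eps / k)) with (k * v - eps) in H; auto.
  field; lra.
Qed.

(** No limit is involved: [phi] carries compact intervals of [D] to compact intervals of [D'], and
    the monotone right inverse [psi] shows that each of the latter is reached. *)
Lemma sup_integral_subst D D' g phi dphi psi v :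
  open_interval D -> open_interval D' ->
  (forall x, D' x -> continuous g x) ->
  (forall x, D x -> D' (phi x) /\ is_derive phi x (dphi x) /\ continuous dphi x) ->
  (forall x y, D x -> D y -> x <= y -> phi x <= phi y) ->
  (forall y, D' y -> D (psi y) /\ phi (psi y) = y) ->
  (forall x y, D' x -> D' y -> x <= y -> psi x <= psi y) ->
  sup_integral D' g v -> sup_integral D (fun x => dphi x * g (phi x)) v.
Proof.
intros HD HD' Hg Hphi Hm Hpsi Hm' [H1 H2].
assert (E : forall a b, D a -> D b -> a <= b ->
   RInt (fun x => dphi x * g (phi x)) a b = RInt g (phi a) (phi b)).
{ intros a b Ha Hb Hab.
  apply (@RInt_comp R_CompleteNormedModule g phi dphi a b);
    rewrite Rmin_left, Rmax_right by lra; intros x Hx;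
    assert (Dx : D x) by now apply (oi_convex _ HD a x b).
  - apply Hg. now apply Hphi.
  - now apply Hphi. }
split.
- intros a b Ha Hb Hab. rewrite E; auto. apply H1; try now apply Hphi. now apply Hm.
- intros eps Heps. destruct (H2 eps Heps) as (a & b & Ha & Hb & Hab & H).
  exists (psi a), (psi b). destruct (Hpsi a Ha) as [Da Ea], (Hpsi b Hb) as [Db Eb].
  repeat split; auto. rewrite E; auto. now rewrite Ea, Eb.
Qed.

(** * Integrals with a parameter and exchange of the order of integration *)

Lemma continuous_RInt_param (f : R -> R -> R) (c d x0 : R) : c <= d ->
  locally x0 (fun x => ex_RInt (f x) c d) ->
  (forall w, c <= w <= d -> continuity_2d_pt f x0 w) ->
  continuous (fun x => RInt (f x) c d) x0.
Proof.
intros Hcd He Hf. apply filterlim_locally. intros eps.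
(* The added 1 covers the case [c = d] and leaves room for a strict inequality at the end. *)
assert (Hp : 0 < eps / (d - c + 1)).
{ apply Rdiv_lt_0_compat; [apply cond_pos | lra]. }
destruct (uniform_continuity_2d_1d' f c d x0 Hf (mkposreal _ Hp)) as [delta Hd].
assert (He0 := locally_singleton _ _ He).
generalize (filter_and _ _ He (locally_ball x0 delta)). apply filter_imp.
intros x [Hx Hb].
change (Rabs (RInt (f x) c d - RInt (f x0) c d) < eps).
change (Rabs (x - x0) < delta) in Hb. apply Rabs_def2 in Hb.
replace (RInt (f x) c d - RInt (f x0) c d) with (RInt (fun w => f x w - f x0 w) c d)
  by exact (@RInt_minus R_CompleteNormedModule (f x) (f x0) c d Hx He0).
apply Rle_lt_trans with ((d - c) * (eps / (d - c + 1))).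
- apply abs_RInt_le_const; auto.
  + exact (@ex_RInt_minus R_NormedModule (f x) (f x0) c d Hx He0).
  + intros w Hw. left.
    assert (Hdp := cond_pos delta).
    apply (Hd w x0 w x); auto; try lra. rewrite Rminus_diag, Rabs_R0. apply cond_pos.
- assert (Hep := cond_pos eps). apply Rlt_le_trans with ((d - c + 1) * (eps / (d - c + 1))).
  + apply Rmult_lt_compat_r; lra.
  + right. field. lra.
Qed.

Lemma continuity_2d_pt_swap (f : R -> R -> R) x y :
  continuity_2d_pt f x y -> continuity_2d_pt (fun u v => f v u) y x.
Proof.
intros H eps. destruct (H eps) as [delta Hd]. exists delta. intros u v Hu Hv. now apply Hd.
Qed.

Lemma continuity_2d_pt_slice_r (f : R -> R -> R) x y :
  continuity_2d_pt f x y -> continuous (f x) y.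
Proof.
intros H. apply filterlim_locally. intros eps. destruct (H eps) as [delta Hd].
exists delta. intros v Hv. apply Hd.
- rewrite Rminus_diag, Rabs_R0. apply cond_pos.
- exact Hv.
Qed.

Lemma continuity_2d_pt_slice_l (f : R -> R -> R) x y :
  continuity_2d_pt f x y -> continuous (fun u => f u y) x.
Proof.
intros H. exact (continuity_2d_pt_slice_r _ _ _ (continuity_2d_pt_swap _ _ _ H)).
Qed.

Section Tonelli.

Variables (D1 D2 : R -> Prop) (f : R -> R -> R).
Hypothesis HD1 : open_interval D1.
Hypothesis HD2 : open_interval D2.
Hypothesis Hf : forall x y, D1 x -> D2 y -> continuity_2d_pt f x y.

Lemma ex_RInt_slice_r x c d : D1 x -> D2 c -> D2 d -> c <= d -> ex_RInt (f x) c d.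
Proof.
intros Hx Hc Hd Hcd. apply (ex_RInt_interval D2); auto.
intros y Hy. apply continuity_2d_pt_slice_r; auto.
Qed.

Lemma ex_RInt_slice_l y a b : D2 y -> D1 a -> D1 b -> a <= b ->
  ex_RInt (fun x => f x y) a b.
Proof.
intros Hy Ha Hb Hab. apply (ex_RInt_interval D1); auto.
intros x Hx. apply continuity_2d_pt_slice_l; auto.
Qed.

Lemma continuous_inner_r c d x : D2 c -> D2 d -> c <= d -> D1 x ->
  continuous (fun x => RInt (f x) c d) x.
Proof.
intros Hc Hd Hcd Hx. apply continuous_RInt_param; auto.
- generalize (oi_open _ HD1 x Hx). apply filter_imp. intros; now apply ex_RInt_slice_r.
- intros w Hw. apply Hf; auto. now apply (oi_convex _ HD2 c w d).
Qed.

Lemma continuous_inner_l a b y : D1 a -> D1 b -> a <= b -> D2 y ->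
  continuous (fun y => RInt (fun x => f x y) a b) y.
Proof.
intros Ha Hb Hab Hy. apply (continuous_RInt_param (fun y x => f x y)); auto.
- generalize (oi_open _ HD2 y Hy). apply filter_imp. intros; now apply ex_RInt_slice_l.
- intros w Hw. apply continuity_2d_pt_swap, Hf; auto. now apply (oi_convex _ HD1 a w b).
Qed.

(* Both iterated integrals, as functions of the upper limit of the outer
   variable, have the same derivative. *)
Lemma RInt_fubini a b c d : D1 a -> D1 b -> a <= b -> D2 c -> D2 d -> c <= d ->
  RInt (fun x => RInt (f x) c d) a b = RInt (fun y => RInt (fun x => f x y) a b) c d.
Proof.
intros Ha Hb Hab Hc Hd Hcd.
set (P := fun z => RInt (fun x => RInt (f x) c d) a z).
set (Q := fun z => RInt (fun y => RInt (fun x => f x y) a z) c d).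
change (P b = Q b).
assert (Hder : forall y z, D2 y -> D1 z ->
  is_derive (fun z => RInt (fun x => f x y) a z) z (f z y)).
{ intros y z Hy Hz.
  apply (is_derive_RInt (V := R_NormedModule) (fun x => f x y) _ a z).
  - generalize (oi_open _ HD1 z Hz). apply filter_imp. intros u Hu.
    apply (@RInt_correct R_CompleteNormedModule).
    (* A neighbour [u] of [z] may lie to the left of [a], where the integral runs backwards. *)
    destruct (Rle_dec a u).
    + now apply ex_RInt_slice_l.
    + apply ex_RInt_swap, ex_RInt_slice_l; auto; lra.
  - apply continuity_2d_pt_slice_l; auto. }
assert (HP : forall z, a <= z <= b -> is_derive P z (RInt (f z) c d)).
{ intros z Hz. assert (Dz : D1 z) by now apply (oi_convex _ HD1 a z b).
  apply (is_derive_RInt (V := R_NormedModule) (fun x => RInt (f x) c d) _ a z).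
  - generalize (oi_open _ HD1 z Dz). apply filter_imp. intros u Hu.
    apply (@RInt_correct R_CompleteNormedModule).
    destruct (Rle_dec a u); [|apply ex_RInt_swap];
    apply (ex_RInt_interval D1); auto; try lra; intros; now apply continuous_inner_r.
  - now apply continuous_inner_r. }
assert (HQ : forall z, a <= z <= b -> is_derive Q z (RInt (f z) c d)).
{ intros z Hz. assert (Dz : D1 z) by now apply (oi_convex _ HD1 a z b).
  replace (RInt (f z) c d) with
    (RInt (fun y => Derive (fun z => RInt (fun x => f x y) a z) z) c d).
  2:{ apply RInt_ext. rewrite Rmin_left, Rmax_right by lra. intros y Hy.
      apply is_derive_unique, Hder; auto. apply (oi_convex _ HD2 c y d); auto; lra. }
  apply (is_derive_RInt_param (fun z y => RInt (fun x => f x y) a z) c d z).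
  - generalize (oi_open _ HD1 z Dz). apply filter_imp. intros u Hu y.
    rewrite Rmin_left, Rmax_right by lra. intros Hy. eexists. apply Hder; auto.
    now apply (oi_convex _ HD2 c y d).
  - intros y. rewrite Rmin_left, Rmax_right by lra. intros Hy.
    assert (Dy : D2 y) by now apply (oi_convex _ HD2 c y d).
    apply continuity_2d_pt_ext_loc with f; auto.
    destruct (oi_open _ HD1 z Dz) as [e1 He1], (oi_open _ HD2 y Dy) as [e2 He2].
    assert (He : 0 < Rmin e1 e2) by (apply Rmin_pos; apply cond_pos).
    exists (mkposreal _ He). simpl. intros u v Hu Hv. symmetry.
    apply is_derive_unique, Hder.
    + apply He2. apply Rlt_le_trans with (1 := Hv), Rmin_r.
    + apply He1. apply Rlt_le_trans with (1 := Hu), Rmin_l.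
  - generalize (oi_open _ HD1 z Dz). apply filter_imp. intros u Hu.
    destruct (Rle_dec a u).
    + apply (ex_RInt_interval D2); auto. intros; now apply continuous_inner_l.
    + apply ex_RInt_ext with (fun y => opp (RInt (fun x => f x y) u a)).
      * rewrite Rmin_left, Rmax_right by lra. intros y Hy.
        apply (@opp_RInt_swap R_CompleteNormedModule).
        apply ex_RInt_slice_l; auto; try lra.
        apply (oi_convex _ HD2 c y d); auto; lra.
      * apply (@ex_RInt_opp R_NormedModule).
        apply (ex_RInt_interval D2); auto. intros; apply continuous_inner_l; auto; lra. }
assert (E : forall z, a <= z <= b -> is_derive (fun z => P z - Q z) z 0).
{ intros z Hz. replace 0 with (RInt (f z) c d - RInt (f z) c d) by ring.
  apply (@is_derive_minus R_AbsRing R_NormedModule P Q); auto. }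
assert (HPa : P a = 0) by apply (@RInt_point R_CompleteNormedModule).
assert (HQa : Q a = 0).
{ unfold Q. rewrite (RInt_ext _ (fun _ => 0)).
  - rewrite RInt_const. unfold scal; simpl; unfold mult; simpl. ring.
  - intros. apply (@RInt_point R_CompleteNormedModule). }
destruct (MVT_gen (fun z => P z - Q z) a b (fun _ => 0)) as (z & _ & Hz).
- rewrite Rmin_left, Rmax_right by lra. intros; apply E; lra.
- rewrite Rmin_left, Rmax_right by lra. intros z Hz.
  apply continuity_pt_filterlim.
  apply (ex_derive_continuous (fun z => P z - Q z)). eexists; now apply E.
- lra.
Qed.

(* Uniform approximation of the inner integrals on compacts is what lets the
   rectangle identity pass to the limit without measure theory. *)
Lemma sup_integral_tonelli (F G : R -> R) (L : R) :
  (forall x, D1 x -> continuous F x) -> (forall y, D2 y -> continuous G y) ->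
  (forall x, D1 x -> sup_integral D2 (f x) (F x)) ->
  (forall y, D2 y -> sup_integral D1 (fun x => f x y) (G y)) ->
  (forall a b eps, D1 a -> D1 b -> a <= b -> 0 < eps ->
     exists c d, D2 c /\ D2 d /\ c <= d /\
       forall x, a <= x <= b -> F x - eps <= RInt (f x) c d) ->
  (forall c d eps, D2 c -> D2 d -> c <= d -> 0 < eps ->
     exists a b, D1 a /\ D1 b /\ a <= b /\
       forall y, c <= y <= d -> G y - eps <= RInt (fun x => f x y) a b) ->
  sup_integral D2 G L -> sup_integral D1 F L.
Proof.
intros HFc HGc HF HG UF UG [L1 L2].
assert (small : forall e k, 0 < e -> 0 <= k -> exists e', 0 < e' /\ k * e' < e).
{ intros e k He Hk. exists (e / (k + 1)). split.
  - apply Rdiv_lt_0_compat; lra.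
  - apply Rlt_le_trans with ((k + 1) * (e / (k + 1))).
    + apply Rmult_lt_compat_r; [apply Rdiv_lt_0_compat|]; lra.
    + right. field. lra. }
assert (shift : forall (h : R -> R) e u v, ex_RInt h u v ->
   ex_RInt (fun x => h x - e) u v /\ RInt (fun x => h x - e) u v = RInt h u v - (v - u) * e).
{ intros h e u v He. split.
  - apply (@ex_RInt_minus R_NormedModule h (fun _ => e)); auto. apply ex_RInt_const.
  - replace ((v - u) * e) with (RInt (fun _ => e) u v)
      by exact (@RInt_const R_CompleteNormedModule u v e).
    apply (@RInt_minus R_CompleteNormedModule h (fun _ => e)); auto. apply ex_RInt_const. }
split.
(* An excess of the integral of [F] over [L] would survive the small uniform error [e], whereas on
   the rectangle the double integral is at most that of [G]. *)
- intros a b Ha Hb Hab. apply Rnot_lt_le. intros Hl.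
  destruct (small (RInt F a b - L) (b - a)) as (e & He & He'); try lra.
  destruct (UF a b e) as (c & d & Hc & Hd & Hcd & H); auto.
  assert (HFi : ex_RInt F a b) by now apply (ex_RInt_interval D1).
  destruct (shift F e a b HFi) as [S1 S2].
  assert (RInt F a b - (b - a) * e <= RInt (fun x => RInt (f x) c d) a b).
  { rewrite <- S2. apply RInt_le; auto.
    - apply (ex_RInt_interval D1); auto. intros; now apply continuous_inner_r.
    - intros x Hx. apply H; lra. }
  assert (RInt (fun y => RInt (fun x => f x y) a b) c d <= RInt G c d).
  { apply RInt_le; auto.
    - apply (ex_RInt_interval D2); auto. intros; now apply continuous_inner_l.
    - now apply (ex_RInt_interval D2).
    - intros y Hy. apply HG; auto. apply (oi_convex _ HD2 c y d); auto; lra. }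
  assert (E := RInt_fubini a b c d Ha Hb Hab Hc Hd Hcd).
  assert (RInt G c d <= L) by now apply L1. lra.
(* Half of [eps] pays for truncating the integral of [G], the other half for truncating the inner
   integrals. *)
- intros eps Heps. destruct (L2 (eps / 2) ltac:(lra)) as (c & d & Hc & Hd & Hcd & HL).
  destruct (small (eps / 2) (d - c)) as (e & He & He'); try lra.
  destruct (UG c d e) as (a & b & Ha & Hb & Hab & H); auto.
  exists a, b. repeat split; auto.
  assert (HGi : ex_RInt G c d) by now apply (ex_RInt_interval D2).
  destruct (shift G e c d HGi) as [S1 S2].
  assert (RInt G c d - (d - c) * e <= RInt (fun y => RInt (fun x => f x y) a b) c d).
  { rewrite <- S2. apply RInt_le; auto.
    - apply (ex_RInt_interval D2); auto. intros; now apply continuous_inner_l.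
    - intros y Hy. apply H; lra. }
  assert (RInt (fun x => RInt (f x) c d) a b <= RInt F a b).
  { apply RInt_le; auto.
    - apply (ex_RInt_interval D1); auto. intros; now apply continuous_inner_r.
    - now apply (ex_RInt_interval D1).
    - intros x Hx. apply HF; auto. apply (oi_convex _ HD1 a x b); auto; lra. }
  assert (E := RInt_fubini a b c d Ha Hb Hab Hc Hd Hcd). lra.
Qed.

End Tonelli.

(** * The Gamma function *)

Ltac real_eq := match goal with |- @eq _ ?x ?y => change (@eq R x y) end.

Lemma Rpower_pos x s : 0 < Rpower x s.
Proof. apply exp_pos. Qed.

Lemma is_derive_Rpower s x : 0 < x ->
  is_derive (fun w => Rpower w s) x (s * Rpower x (s - 1)).
Proof. intros Hx. apply is_derive_Reals. now apply derivable_pt_lim_power. Qed.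

Lemma continuous_Rpower s x : 0 < x -> continuous (fun w => Rpower w s) x.
Proof.
intros Hx. apply (ex_derive_continuous (fun w => Rpower w s)).
eexists. now apply is_derive_Rpower.
Qed.

Lemma ln_lt_self y : 0 < y -> ln y < y.
Proof.
intros Hy. rewrite <- (ln_exp y) at 2. apply ln_increasing; auto.
assert (H := exp_ineq1 y ltac:(lra)). lra.
Qed.

(** This is [ln y < y] at [y = w / (2 * s)]. The rate one half serves two purposes: the square of
    the bound grows only like [exp w], and its product with [exp (- w)] still decays. *)
Lemma Rpower_le_exp_half s w : 0 < s -> 0 < w ->
  Rpower w s <= exp (s * ln (2 * s)) * exp (w / 2).
Proof.
intros Hs Hw. unfold Rpower. rewrite <- exp_plus.
assert (Hd : 0 < w / (2 * s)) by (apply Rdiv_lt_0_compat; lra).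
assert (H := ln_lt_self _ Hd).
unfold Rdiv in H at 1. rewrite ln_mult, ln_Rinv in H; try lra.
2: apply Rinv_0_lt_compat; lra.
apply (Rmult_lt_compat_l s) in H; auto.
replace (s * (w / (2 * s))) with (w / 2) in H by (field; lra).
left. apply exp_increasing. lra.
Qed.

Definition gamma_integrand (s w : R) : R := Rpower w (s - 1) * exp (- w).

Lemma gamma_integrand_pos s w : 0 < gamma_integrand s w.
Proof. apply Rmult_lt_0_compat; apply exp_pos. Qed.

Lemma gamma_integrand_continuous s w : 0 < w -> continuous (gamma_integrand s) w.
Proof.
intros Hw. apply (continuous_mult (fun w => Rpower w (s - 1)) (fun w => exp (- w))).
- now apply continuous_Rpower.
- apply (ex_derive_continuous (fun w => exp (- w))). auto_derive. auto.
Qed.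

(* [w^(s-1) e^(-w)] is dominated by a multiple of the derivative of the bounded
   function [w^s / (1 + w^s)]; this handles both ends at once. *)
Lemma gamma_integrand_bounded s : 0 < s ->
  exists M, forall a b, 0 < a -> 0 < b -> a <= b -> RInt (gamma_integrand s) a b <= M.
Proof.
intros Hs. set (K := exp (s * ln (2 * s))).
assert (HK : 0 < K) by apply exp_pos.
(* [C * s] is the constant [(1 + K) ^ 2] that bounds [(1 + w^s)^2 e^(-w)]. *)
set (C := (1 + K) ^ 2 / s).
assert (HC : 0 < C) by (apply Rdiv_lt_0_compat; [apply pow_lt|]; lra).
exists C. intros a b Ha Hb Hab.
(* This differs from [C w^s / (1 + w^s)] by the constant [C]; the power occurs only once, which
   eases differentiation. *)
set (H := fun w => - C * / (1 + Rpower w s)).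
set (h := fun w => C * (s * Rpower w (s - 1) / (1 + Rpower w s) ^ 2)).
assert (Hd : forall w, 0 < w -> is_derive H w (h w)).
{ intros w Hw. assert (Hp := Rpower_pos w s).
  assert (Hr := is_derive_Rpower s w Hw).
  assert (Hi : is_derive (fun w => 1 + Rpower w s) w (s * Rpower w (s - 1))).
  { replace (s * Rpower w (s - 1)) with (0 + s * Rpower w (s - 1)) by ring.
    apply (@is_derive_plus R_AbsRing R_NormedModule (fun _ => 1) (fun w => Rpower w s)).
    - apply @is_derive_const.
    - exact Hr. }
  assert (Hv := is_derive_inv _ w _ Hi ltac:(lra)).
  apply (is_derive_scal _ w (- C)) in Hv.
  replace (h w) with (- C * (- (s * Rpower w (s - 1)) / (1 + Rpower w s) ^ 2)).
  - exact Hv.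
  - unfold h. field. lra. }
assert (Hc : forall w, 0 < w -> continuous h w).
{ intros w Hw. assert (Hp := Rpower_pos w s).
  apply (continuous_ext (fun w => (C * s) * (Rpower w (s - 1) * / (1 + Rpower w s) ^ 2))).
  { intros. real_eq. unfold h, Rdiv. ring. }
  apply (continuous_scal_r (C * s) (fun w => Rpower w (s - 1) * / (1 + Rpower w s) ^ 2)).
  apply (continuous_mult (fun w => Rpower w (s - 1)) (fun w => / (1 + Rpower w s) ^ 2)).
  - now apply continuous_Rpower.
  - apply (continuous_comp (fun w => Rpower w s) (fun z => / (1 + z) ^ 2)).
    + now apply continuous_Rpower.
    + apply (ex_derive_continuous (fun z => / (1 + z) ^ 2)). auto_derive.
      assert (0 < (1 + Rpower w s) ^ 2) by (apply pow_lt; lra). simpl in *. lra. }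
assert (HI : is_RInt h a b (H b - H a)).
{ apply (is_RInt_derive (V := R_CompleteNormedModule) H h);
  rewrite Rmin_left, Rmax_right by lra; intros x Hx; [apply Hd | apply Hc]; lra. }
apply Rle_trans with (H b - H a).
- apply (is_RInt_le (gamma_integrand s) h a b); auto.
  + apply (@RInt_correct R_CompleteNormedModule).
    apply (ex_RInt_interval (fun x => 0 < x)); auto.
    * apply (ie_interval _ _ _ positive_ends).
    * apply gamma_integrand_continuous.
  + intros w Hw. assert (Hw0 : 0 < w) by lra. unfold h, gamma_integrand.
    assert (Hp := Rpower_pos w s). assert (Hp1 := Rpower_pos w (s - 1)).
    assert (HB := Rpower_le_exp_half s w Hs Hw0). fold K in HB.
    assert (H1 : 1 <= exp (w / 2)).
    { rewrite <- exp_0. left. apply exp_increasing. lra. }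
    assert (HS : (1 + Rpower w s) ^ 2 <= (1 + K) ^ 2 * exp w).
    { replace (exp w) with (exp (w / 2) ^ 2).
      - rewrite <- Rpow_mult_distr. apply pow_incr. lra.
      - simpl. rewrite Rmult_1_r, <- exp_plus. f_equal. field. }
    assert (Hq : 0 < (1 + Rpower w s) ^ 2) by (apply pow_lt; lra).
    replace (C * (s * Rpower w (s - 1) / (1 + Rpower w s) ^ 2))
      with (Rpower w (s - 1) * ((1 + K) ^ 2 / (1 + Rpower w s) ^ 2)).
    2:{ unfold C. field. lra. }
    apply Rmult_le_compat_l; [lra|].
    rewrite exp_Ropp. assert (He := exp_pos w).
    apply Rmult_le_reg_r with (exp w * (1 + Rpower w s) ^ 2).
    { apply Rmult_lt_0_compat; auto. }
    replace (/ exp w * (exp w * (1 + Rpower w s) ^ 2)) with ((1 + Rpower w s) ^ 2)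
      by (field; lra).
    replace ((1 + K) ^ 2 / (1 + Rpower w s) ^ 2 * (exp w * (1 + Rpower w s) ^ 2))
      with ((1 + K) ^ 2 * exp w) by (field; lra).
    exact HS.
- unfold H. assert (Ha' := Rpower_pos a s). assert (Hb' := Rpower_pos b s).
  assert (Hi1 : 0 < / (1 + Rpower b s)) by (apply Rinv_0_lt_compat; lra).
  assert (Hi2 : / (1 + Rpower a s) < 1).
  { rewrite <- Rinv_1. apply Rinv_lt_contravar; lra. }
  assert (C * / (1 + Rpower a s) <= C * 1) by (apply Rmult_le_compat_l; lra).
  assert (0 < C * / (1 + Rpower b s)) by (apply Rmult_lt_0_compat; lra). lra.
Qed.

Lemma RInt_gen_positive_unique (f : R -> R) (v : R) :
  is_RInt_gen f (at_right 0) (Rbar_locally p_infty) v ->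
  RInt_gen f (at_right 0) (Rbar_locally p_infty) = v.
Proof.
exact (@is_RInt_gen_unique R_CompleteNormedModule _ _ _ _ f v).
Qed.

(** [RInt_gen] is a total operator, so its value carries information only after convergence is
    proved: boundedness yields a supremum, the supremum a limit, and uniqueness identifies it with
    [Gamma s]. *)
Lemma Gamma_correct s : 0 < s ->
  sup_integral (fun x => 0 < x) (gamma_integrand s) (Gamma s) /\
  is_RInt_gen (gamma_integrand s) (at_right 0) (Rbar_locally p_infty) (Gamma s).
Proof.
intros Hs. destruct (gamma_integrand_bounded s Hs) as [M HM].
assert (HI := ie_interval _ _ _ positive_ends).
destruct (sup_integral_exists (fun x => 0 < x) (gamma_integrand s) M) as [v Hv]; auto.
{ exists 1. lra. }
assert (Hg : is_RInt_gen (gamma_integrand s) (at_right 0) (Rbar_locally p_infty) v).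
{ apply (sup_integral_RInt_gen (fun x => 0 < x)); auto.
  - exact positive_ends.
  - apply at_right_proper_filter.
  - apply Rbar_locally_filter.
  - apply gamma_integrand_continuous.
  - intros. left. apply gamma_integrand_pos. }
enough (E : Gamma s = v) by now rewrite E.
exact (RInt_gen_positive_unique _ _ Hg).
Qed.

Lemma Gamma_sup s : 0 < s ->
  sup_integral (fun x => 0 < x) (gamma_integrand s) (Gamma s).
Proof. intros. now apply Gamma_correct. Qed.

Lemma Gamma_pos s : 0 < s -> 0 < Gamma s.
Proof.
intros Hs. apply Rlt_le_trans with (RInt (gamma_integrand s) 1 2).
- apply RInt_gt_0; [lra | |].
  + intros. apply gamma_integrand_pos.
  + intros. apply gamma_integrand_continuous. lra.
- apply Gamma_sup; lra.
Qed.

(** The one-sided filter matters: [ln 0] defaults to 0, so [Rpower 0 s] is 1 and not the limit. *)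
Lemma Rpower_at_right_0 s : 0 < s ->
  filterlim (fun x => Rpower x s) (at_right 0) (locally 0).
Proof.
intros Hs. apply filterlim_locally. intros eps.
exists (mkposreal (Rpower eps (/ s)) (Rpower_pos _ _)). intros y Hy Hy0.
change (Rabs (y - 0) < Rpower eps (/ s)) in Hy.
change (Rabs (Rpower y s - 0) < eps).
rewrite Rminus_0_r in *. rewrite Rabs_pos_eq in * by (try apply Rlt_le, Rpower_pos; lra).
replace (pos eps) with (Rpower (Rpower eps (/ s)) s).
- apply Rlt_Rpower_l; lra.
- rewrite Rpower_mult, Rinv_l, Rpower_1; auto; [apply cond_pos | lra].
Qed.

(** Integration by parts: [w^s e^(-w)] vanishes at both ends, so its derivative integrates to 0;
    split into its two terms, the same derivative integrates to [s * Gamma s - Gamma (s + 1)]. *)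
Lemma Gamma_succ s : 0 < s -> Gamma (s + 1) = s * Gamma s.
Proof.
intros Hs.
destruct (Gamma_correct s Hs) as [_ H0].
destruct (Gamma_correct (s + 1) ltac:(lra)) as [_ H1].
set (H := fun w => Rpower w s * exp (- w)).
set (h := fun w => s * gamma_integrand s w - gamma_integrand (s + 1) w).
assert (Hd : forall w, 0 < w -> is_derive H w (h w)).
{ intros w Hw. assert (Hr := is_derive_Rpower s w Hw).
  assert (He : is_derive (fun w => exp (- w)) w (- exp (- w))).
  { auto_derive; auto. ring. }
  assert (Hm := is_derive_mult _ _ w _ _ Hr He ltac:(intros; apply Rmult_comm)).
  replace (h w) with (s * Rpower w (s - 1) * exp (- w) + Rpower w s * - exp (- w)).
  - exact Hm.
  - unfold h, gamma_integrand. replace (s + 1 - 1) with s by ring. ring. }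
assert (Hpos : filter_prod (at_right 0) (Rbar_locally p_infty)
   (fun ab : R * R => forall x, Rmin (fst ab) (snd ab) <= x <= Rmax (fst ab) (snd ab) -> 0 < x)).
{ exists (fun x => 0 < x /\ x <= 1) (fun x => 0 < x /\ 1 <= x).
  - apply (ie_left _ _ _ positive_ends). lra.
  - apply (ie_right _ _ _ positive_ends). lra.
  - intros x y Hx Hy z; simpl. rewrite Rmin_left, Rmax_right by lra. lra. }
assert (HG : is_RInt_gen (Derive H) (at_right 0) (Rbar_locally p_infty) (0 - 0)).
{ apply is_RInt_gen_Derive.
  - revert Hpos. apply filter_imp. intros ab Hab x Hx. eexists. now apply Hd, Hab.
  - revert Hpos. apply filter_imp. intros ab Hab x Hx. specialize (Hab x Hx).
    apply (continuous_ext_loc (Derive H) h x).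
    + generalize (open_gt 0 x Hab). apply filter_imp. intros y Hy. symmetry.
      now apply is_derive_unique, Hd.
    + apply (continuous_minus (fun w => s * gamma_integrand s w) (gamma_integrand (s + 1))).
      * apply (continuous_scal_r s (gamma_integrand s)). now apply gamma_integrand_continuous.
      * now apply gamma_integrand_continuous.
  - apply (filterlim_le_le (F := at_right 0) (fun _ => 0) H (fun x => Rpower x s) (Finite 0)).
    + exists (mkposreal 1 Rlt_0_1). intros x _ Hx. unfold H.
      assert (Hp := Rpower_pos x s). split.
      * left. apply Rmult_lt_0_compat; [auto | apply exp_pos].
      * rewrite <- (Rmult_1_r (Rpower x s)) at 2. apply Rmult_le_compat_l; [lra|].
        rewrite <- exp_0. left. apply exp_increasing. lra.
    + apply filterlim_const.
    + now apply Rpower_at_right_0.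
  - set (K := exp (s * ln (2 * s))).
    apply (filterlim_le_le (F := Rbar_locally p_infty) (fun _ => 0) H (fun x => K * exp (- x / 2)) (Finite 0)).
    + exists 0. intros x Hx. unfold H. assert (Hp := Rpower_pos x s). split.
      * left. apply Rmult_lt_0_compat; [auto | apply exp_pos].
      * apply Rle_trans with (K * exp (x / 2) * exp (- x)).
        -- apply Rmult_le_compat_r; [left; apply exp_pos|]. now apply Rpower_le_exp_half.
        -- rewrite Rmult_assoc, <- exp_plus. right. f_equal. f_equal. field.
    + apply filterlim_const.
    + change (is_lim (fun x => K * exp (- x / 2)) p_infty (Finite 0)).
      replace (Finite 0) with (Rbar_mult K 0) by (simpl; f_equal; ring).
      apply is_lim_scal_l.
      apply (is_lim_comp exp (fun x => - x / 2) p_infty 0 m_infty is_lim_exp_m).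
      * apply is_lim_ext with (fun x => - / 2 * x). { intros; field. }
        replace m_infty with (Rbar_mult (- / 2) p_infty).
        -- apply is_lim_scal_l, is_lim_id.
        -- unfold Rbar_mult, Rbar_mult'. destruct (Rle_dec 0 (- / 2)) as [r|r]; [exfalso; clear - r; lra | reflexivity].
      * exists 0. intros x _. discriminate. }
assert (HE : is_RInt_gen (Derive H) (at_right 0) (Rbar_locally p_infty)
               (s * Gamma s - Gamma (s + 1))).
{ apply is_RInt_gen_ext with h.
  - revert Hpos. apply filter_imp. intros ab Hab x Hx. symmetry.
    apply is_derive_unique, Hd, Hab. lra.
  - apply (is_RInt_gen_minus (V := R_NormedModule)
             (fun w => s * gamma_integrand s w) (gamma_integrand (s + 1))); auto.
    now apply (is_RInt_gen_scal (V := R_NormedModule) (gamma_integrand s) s). }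
assert (E1 := RInt_gen_positive_unique _ _ HG).
assert (E2 := RInt_gen_positive_unique _ _ HE).
rewrite E1 in E2. lra.
Qed.

(** * The Beta integral *)

Lemma Rpower_mult_base x y s : 0 < x -> 0 < y ->
  Rpower (x * y) s = Rpower x s * Rpower y s.
Proof. intros. symmetry. now apply Rpower_mult_distr. Qed.

Lemma gamma_rescale s k w : 0 < k -> 0 < w ->
  Rpower w (s - 1) * exp (- (k * w)) = Rpower k (- s) * (k * gamma_integrand s (k * w)).
Proof.
intros Hk Hw. unfold gamma_integrand. rewrite Rpower_mult_base by auto.
rewrite <- (Rpower_1 k) at 3 by auto.
transitivity ((Rpower k (- s) * Rpower k 1 * Rpower k (s - 1)) * (Rpower w (s - 1) * exp (- (k * w)))).
- rewrite <- !Rpower_plus. replace (- s + 1 + (s - 1)) with 0 by ring.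
  rewrite Rpower_O; auto. ring.
- ring.
Qed.

Lemma gamma_scaled_continuous s k w : 0 < w ->
  continuous (fun w => Rpower w (s - 1) * exp (- (k * w))) w.
Proof.
intros Hw. apply (continuous_mult (fun w => Rpower w (s - 1)) (fun w => exp (- (k * w)))).
- now apply continuous_Rpower.
- apply (ex_derive_continuous (fun w => exp (- (k * w)))). auto_derive. auto.
Qed.

Lemma Gamma_scaled_sup s k : 0 < s -> 0 < k ->
  sup_integral (fun x => 0 < x) (fun w => Rpower w (s - 1) * exp (- (k * w)))
    (Rpower k (- s) * Gamma s).
Proof.
intros Hs Hk. assert (HI := ie_interval _ _ _ positive_ends).
assert (Hc : forall x, 0 < x -> continuous (fun w => k * gamma_integrand s (k * w)) x).
{ intros x Hx. apply (continuous_scal_r k (fun w => gamma_integrand s (k * w))).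
  apply (continuous_comp (fun w => k * w) (gamma_integrand s)).
  - apply (ex_derive_continuous (fun w => k * w)). auto_derive. auto.
  - apply gamma_integrand_continuous. now apply Rmult_lt_0_compat. }
apply sup_integral_ext with (fun w => Rpower k (- s) * (k * gamma_integrand s (k * w))); auto.
{ intros x Hx. symmetry. now apply gamma_rescale. }
apply (sup_integral_scal (fun x => 0 < x) (fun w => k * gamma_integrand s (k * w))); auto.
{ apply Rpower_pos. }
apply (sup_integral_subst (fun x => 0 < x) (fun x => 0 < x) (gamma_integrand s)
         (fun w => k * w) (fun _ => k) (fun y => y / k)); auto.
- apply gamma_integrand_continuous.
- intros x Hx. split; [|split].
  + now apply Rmult_lt_0_compat.
  + auto_derive; auto. real_eq. ring.
  + apply continuous_const.
- intros x y _ _ Hxy. apply Rmult_le_compat_l; lra.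
- intros y Hy. split; [now apply Rdiv_lt_0_compat | field; lra].
- intros x y _ _ Hxy. apply Rmult_le_compat_r; auto. left. now apply Rinv_0_lt_compat.
- now apply Gamma_sup.
Qed.

(** If [[c, d]] is good for [k = 1], then [[c / k, d / k]] is good for [k], and the single window
    [[c / k2, d / k1]] contains all of these. *)
Lemma Gamma_scaled_uniform s k1 k2 delta : 0 < s -> 0 < k1 -> k1 <= k2 -> 0 < delta ->
  exists c d, 0 < c /\ 0 < d /\ c <= d /\ forall k, k1 <= k <= k2 ->
    Rpower k (- s) * (Gamma s - delta) <= RInt (fun w => Rpower w (s - 1) * exp (- (k * w))) c d.
Proof.
intros Hs Hk1 Hk Hd. destruct (Gamma_sup s Hs) as [_ H].
assert (HI := ie_interval _ _ _ positive_ends).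
destruct (H delta Hd) as (c & d & Hc & Hd' & Hcd & HG).
assert (Hck : forall k, k1 <= k <= k2 -> k * (c / k2) <= c).
{ intros k Hk'. apply Rmult_le_reg_r with k2; [lra|].
  replace (k * (c / k2) * k2) with (c * k) by (field; lra). apply Rmult_le_compat_l; lra. }
assert (Hdk : forall k, k1 <= k <= k2 -> d <= k * (d / k1)).
{ intros k Hk'. apply Rmult_le_reg_r with k1; [lra|].
  replace (k * (d / k1) * k1) with (d * k) by (field; lra). apply Rmult_le_compat_l; lra. }
assert (Hc2 : 0 < c / k2) by (apply Rdiv_lt_0_compat; lra).
assert (Hd2 : 0 < d / k1) by (apply Rdiv_lt_0_compat; lra).
assert (Hcd2 : c / k2 <= d / k1).
{ apply Rmult_le_reg_l with k1; [lra|].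
  specialize (Hck k1 ltac:(lra)). specialize (Hdk k1 ltac:(lra)). lra. }
exists (c / k2), (d / k1). repeat split; auto. intros k Hk'.
specialize (Hck k Hk'). specialize (Hdk k Hk').
assert (Hpk : 0 < k) by lra. assert (HR := Rpower_pos k (- s)).
replace (RInt (fun w => Rpower w (s - 1) * exp (- (k * w))) (c / k2) (d / k1))
  with (Rpower k (- s) * RInt (gamma_integrand s) (k * (c / k2)) (k * (d / k1))).
- apply Rmult_le_compat_l; [lra|]. apply Rle_trans with (RInt (gamma_integrand s) c d); [lra|].
  apply (RInt_nonneg_incl (fun x => 0 < x)); auto.
  + apply gamma_integrand_continuous.
  + intros; left; apply gamma_integrand_pos.
  + now apply Rmult_lt_0_compat.
  + now apply Rmult_lt_0_compat.
- assert (E : RInt (fun w => k * gamma_integrand s (k * w)) (c / k2) (d / k1)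
     = RInt (gamma_integrand s) (k * (c / k2)) (k * (d / k1))).
  { apply (@RInt_comp R_CompleteNormedModule (gamma_integrand s) (fun w => k * w) (fun _ => k));
    rewrite Rmin_left, Rmax_right by lra; intros x Hx.
    - apply gamma_integrand_continuous. apply Rmult_lt_0_compat; lra.
    - split; [auto_derive; auto; real_eq; ring | apply continuous_const]. }
  rewrite <- E. symmetry.
  rewrite (RInt_ext _ (fun w => Rpower k (- s) * (k * gamma_integrand s (k * w)))).
  + apply (@RInt_scal R_CompleteNormedModule (fun w => k * gamma_integrand s (k * w))).
    apply (@ex_RInt_continuous R_CompleteNormedModule).
    rewrite Rmin_left, Rmax_right by lra; intros x Hx.
    apply (continuous_scal_r k (fun w => gamma_integrand s (k * w))).
    apply (continuous_comp (fun w => k * w) (gamma_integrand s)).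
    * apply (ex_derive_continuous (fun w => k * w)). auto_derive. auto.
    * apply gamma_integrand_continuous. apply Rmult_lt_0_compat; lra.
  + rewrite Rmin_left, Rmax_right by lra; intros x Hx. apply gamma_rescale; lra.
Qed.

Lemma continuous_bounded (p : R -> R) a b : a <= b ->
  (forall x, a <= x <= b -> continuous p x) ->
  exists M, 0 < M /\ forall x, a <= x <= b -> p x <= M.
Proof.
intros Hab Hp. destruct (continuity_ab_maj p a b Hab) as (m & Hm & _).
- intros. apply continuity_pt_filterlim. now apply Hp.
(* The maximum with 1 makes the bound positive, as it will be a divisor. *)
- exists (Rmax 1 (p m)). split.
  + apply Rlt_le_trans with 1; [lra | apply Rmax_l].
  + intros x Hx. apply Rle_trans with (p m); auto. apply Rmax_r.
Qed.

(** Covers the uniformity requirement of both integration orders: weight [v^(x-1)] with scale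
    [1 + v], and weight [w^(s-1) e^(-w)] with scale [w]. *)
Lemma Gamma_scaled_uniform_weighted s a b (p k : R -> R) eps :
  0 < s -> a <= b -> 0 < eps ->
  (forall x, a <= x <= b -> continuous p x) ->
  (forall x, a <= x <= b -> 0 <= p x) ->
  0 < k a -> (forall x, a <= x <= b -> k a <= k x <= k b) ->
  exists c d, 0 < c /\ 0 < d /\ c <= d /\ forall x, a <= x <= b ->
    p x * (Rpower (k x) (- s) * Gamma s) - eps <=
    p x * RInt (fun w => Rpower w (s - 1) * exp (- (k x * w))) c d.
Proof.
intros Hs Hab He Hp Hp0 Hk0 Hk.
destruct (continuous_bounded p a b Hab Hp) as (M & HM & HMp).
set (N := Rpower (k a) (- s)). assert (HN : 0 < N) by apply Rpower_pos.
(* [M] bounds the weight and [N] bounds [k^(-s)], which is largest at the smallest scale [k a]. *)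
destruct (Gamma_scaled_uniform s (k a) (k b) (eps / (M * N))) as (c & d & Hc & Hd & Hcd & H); auto.
- apply Hk; lra.
- apply Rdiv_lt_0_compat; auto. now apply Rmult_lt_0_compat.
- exists c, d. repeat split; auto. intros x Hx. specialize (H (k x) (Hk x Hx)).
  apply Rle_trans with (p x * (Rpower (k x) (- s) * (Gamma s - eps / (M * N)))).
  2:{ apply Rmult_le_compat_l; auto. }
  assert (HR := Rpower_pos (k x) (- s)).
  assert (HRN : Rpower (k x) (- s) <= N).
  { unfold N. rewrite !Rpower_Ropp. apply Rinv_le_contravar; [apply Rpower_pos|].
    apply Rle_Rpower_l; [lra|]. split; auto. now apply Hk. }
  assert (p x * Rpower (k x) (- s) * (eps / (M * N)) <= eps).
  { apply Rle_trans with (M * N * (eps / (M * N))).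
    - apply Rmult_le_compat_r.
      + left. apply Rdiv_lt_0_compat; auto. now apply Rmult_lt_0_compat.
      + apply Rmult_le_compat; auto; lra.
    - right. field. lra. }
  lra.
Qed.

Lemma continuity_2d_pt_fst (p : R -> R) x y :
  continuous p x -> continuity_2d_pt (fun u _ => p u) x y.
Proof.
intros H. apply (continuity_1d_2d_pt_comp p (fun u _ => u)).
- now apply continuity_pt_filterlim.
- apply continuity_2d_pt_id1.
Qed.

Lemma continuity_2d_pt_snd (p : R -> R) x y :
  continuous p y -> continuity_2d_pt (fun _ v => p v) x y.
Proof. intros H. now apply continuity_2d_pt_swap, (continuity_2d_pt_fst p). Qed.

(* Integrate [v^(x-1) w^(x+y-1) e^(-(1+v)w)] over the quadrant in both orders. *)
Lemma Gamma_product_sup x y : 0 < x -> 0 < y ->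
  sup_integral (fun v => 0 < v)
    (fun v => Rpower v (x - 1) * (Rpower (1 + v) (- (x + y)) * Gamma (x + y)))
    (Gamma x * Gamma y).
Proof.
intros Hx Hy. set (s := x + y). assert (Hs : 0 < s) by (unfold s; lra).
assert (HI := ie_interval _ _ _ positive_ends).
set (f := fun v w => Rpower v (x - 1) * (Rpower w (s - 1) * exp (- ((1 + v) * w)))).
assert (Ef : forall v w,
   f v w = gamma_integrand s w * (Rpower v (x - 1) * exp (- (w * v)))).
{ intros v w. unfold f, gamma_integrand.
  replace (exp (- ((1 + v) * w))) with (exp (- w) * exp (- (w * v))).
  - ring.
  - rewrite <- exp_plus. f_equal. ring. }
(* Integrating out [v] leaves [w^(-x) Gamma x], which lowers the exponent [s - 1] to [y - 1]; this
   is why [s] is [x + y]. *)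
assert (EG : forall w, 0 < w ->
   gamma_integrand s w * (Rpower w (- x) * Gamma x) = Gamma x * gamma_integrand y w).
{ intros w Hw. unfold gamma_integrand.
  replace (y - 1) with (s - 1 + - x) by (unfold s; ring).
  rewrite Rpower_plus. ring. }
apply (sup_integral_tonelli (fun x => 0 < x) (fun x => 0 < x) f) with
  (G := fun w => gamma_integrand s w * (Rpower w (- x) * Gamma x)); auto.
- intros v w Hv Hw. unfold f.
  apply (continuity_2d_pt_mult (fun v _ => Rpower v (x - 1))
           (fun v w => Rpower w (s - 1) * exp (- ((1 + v) * w)))).
  + apply (continuity_2d_pt_fst (fun v => Rpower v (x - 1))). now apply continuous_Rpower.
  + apply (continuity_2d_pt_mult (fun _ w => Rpower w (s - 1)) (fun v w => exp (- ((1 + v) * w)))).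
    * apply (continuity_2d_pt_snd (fun w => Rpower w (s - 1))). now apply continuous_Rpower.
    * apply (continuity_1d_2d_pt_comp exp (fun v w => - ((1 + v) * w))).
      -- apply derivable_continuous_pt, derivable_pt_exp.
      -- apply continuity_2d_pt_opp, continuity_2d_pt_mult.
         ++ apply continuity_2d_pt_plus; [apply continuity_2d_pt_const | apply continuity_2d_pt_id1].
         ++ apply continuity_2d_pt_id2.
- intros v Hv.
  apply (continuous_mult (fun v => Rpower v (x - 1)) (fun v => Rpower (1 + v) (- s) * Gamma s)).
  + now apply continuous_Rpower.
  + apply (continuous_mult (fun v => Rpower (1 + v) (- s)) (fun _ => Gamma s)); [|apply continuous_const].
    apply (continuous_comp (fun v => 1 + v) (fun v => Rpower v (- s))).
    * apply (ex_derive_continuous (fun v => 1 + v)). auto_derive. auto.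
    * apply continuous_Rpower. lra.
- intros w Hw.
  apply (continuous_mult (gamma_integrand s) (fun w => Rpower w (- x) * Gamma x)).
  + now apply gamma_integrand_continuous.
  + apply (continuous_mult (fun w => Rpower w (- x)) (fun _ => Gamma x)); [|apply continuous_const].
    now apply continuous_Rpower.
- intros v Hv. unfold f.
  apply (sup_integral_scal _ (fun w => Rpower w (s - 1) * exp (- ((1 + v) * w)))); auto.
  + intros. now apply gamma_scaled_continuous.
  + apply Rpower_pos.
  + apply Gamma_scaled_sup; lra.
- intros w Hw.
  apply sup_integral_ext with (fun v => gamma_integrand s w * (Rpower v (x - 1) * exp (- (w * v)))); auto.
  apply (sup_integral_scal _ (fun v => Rpower v (x - 1) * exp (- (w * v)))); auto.
  + intros. now apply gamma_scaled_continuous.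
  + apply gamma_integrand_pos.
  + now apply Gamma_scaled_sup.
- intros a b eps Ha Hb Hab He.
  destruct (Gamma_scaled_uniform_weighted s a b (fun v => Rpower v (x - 1)) (fun v => 1 + v) eps)
    as (c & d & Hc & Hd & Hcd & H); auto; try (intros; lra).
  + intros. apply continuous_Rpower. lra.
  + intros. left. apply Rpower_pos.
  + exists c, d. repeat split; auto. intros v Hv.
    replace (RInt (f v) c d)
      with (Rpower v (x - 1) * RInt (fun w => Rpower w (s - 1) * exp (- ((1 + v) * w))) c d).
    * now apply H.
    * symmetry.
      apply (@RInt_scal R_CompleteNormedModule (fun w => Rpower w (s - 1) * exp (- ((1 + v) * w)))).
      apply (ex_RInt_interval (fun x => 0 < x)); auto.
      intros. now apply gamma_scaled_continuous.
- intros c d eps Hc Hd Hcd He.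
  destruct (Gamma_scaled_uniform_weighted x c d (gamma_integrand s) (fun w => w) eps)
    as (a & b & Ha & Hb & Hab & H); auto; try (intros; lra).
  + intros. apply gamma_integrand_continuous. lra.
  + intros. left. apply gamma_integrand_pos.
  + exists a, b. repeat split; auto. intros w Hw.
    replace (RInt (fun v => f v w) a b)
      with (gamma_integrand s w * RInt (fun v => Rpower v (x - 1) * exp (- (w * v))) a b).
    * now apply H.
    * symmetry. rewrite (RInt_ext _ (fun v => gamma_integrand s w * (Rpower v (x - 1) * exp (- (w * v))))) by auto.
      apply (@RInt_scal R_CompleteNormedModule (fun v => Rpower v (x - 1) * exp (- (w * v)))).
      apply (ex_RInt_interval (fun x => 0 < x)); auto.
      intros. now apply gamma_scaled_continuous.
- apply sup_integral_ext with (fun w => Gamma x * gamma_integrand y w); auto.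
  { intros. symmetry. auto. }
  apply sup_integral_scal; auto.
  + apply gamma_integrand_continuous.
  + now apply Gamma_pos.
  + now apply Gamma_sup.
Qed.

(** At [y = 1 - alpha] the second factor is the Caputo kernel. *)
Definition beta_integrand (x y t tau : R) : R := Rpower tau (x - 1) * Rpower (t - tau) (y - 1).

Lemma beta_integrand_continuous x y t tau : 0 < tau < t ->
  continuous (beta_integrand x y t) tau.
Proof.
intros H.
apply (continuous_mult (fun v => Rpower v (x - 1)) (fun v => Rpower (t - v) (y - 1))).
- apply continuous_Rpower; lra.
- apply (continuous_comp (fun v => t - v) (fun v => Rpower v (y - 1))).
  + apply (ex_derive_continuous (fun v => t - v)). auto_derive. auto.
  + apply continuous_Rpower; lra.
Qed.

(** The substitution [v = tau / (t - tau)], for which [1 + v = t / (t - tau)], carries [(0, t)] to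
    the half-line on which [Gamma x * Gamma y] is already an integral. *)
Lemma Beta_sup x y t : 0 < x -> 0 < y -> 0 < t ->
  sup_integral (fun tau => 0 < tau < t) (beta_integrand x y t)
    (Rpower t (x + y - 1) * (Gamma x * Gamma y / Gamma (x + y))).
Proof.
intros Hx Hy Ht. assert (HI := ie_interval _ _ _ positive_ends).
assert (HJ := ie_interval _ _ _ (bounded_ends t Ht)).
assert (HG : 0 < Gamma (x + y)) by (apply Gamma_pos; lra).
set (g := fun v => Rpower v (x - 1) * (Rpower (1 + v) (- (x + y)) * Gamma (x + y))).
assert (Hg : forall v, 0 < v -> continuous g v).
{ intros v Hv.
  apply (continuous_mult (fun v => Rpower v (x - 1)) (fun v => Rpower (1 + v) (- (x + y)) * Gamma (x + y))).
  + now apply continuous_Rpower.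
  + apply (continuous_mult (fun v => Rpower (1 + v) (- (x + y))) (fun _ => Gamma (x + y))); [|apply continuous_const].
    apply (continuous_comp (fun v => 1 + v) (fun v => Rpower v (- (x + y)))).
    * apply (ex_derive_continuous (fun v => 1 + v)). auto_derive. auto.
    * apply continuous_Rpower. lra. }
set (phi := fun tau => tau / (t - tau)). set (dphi := fun tau => t / (t - tau) ^ 2).
assert (Hphi0 : forall tau, 0 < tau < t -> 0 < phi tau).
{ intros tau H. apply Rdiv_lt_0_compat; lra. }
assert (Hdc : forall tau, 0 < tau < t -> continuous dphi tau).
{ intros tau H. apply (ex_derive_continuous dphi). unfold dphi. auto_derive.
  assert (0 < (t - tau) ^ 2) by (apply pow_lt; lra). simpl in *. lra. }
assert (Hdd : forall tau, 0 < tau < t -> is_derive phi tau (dphi tau)).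
{ intros tau H. unfold phi, dphi. auto_derive; [lra|]. real_eq. field. lra. }
set (k := Rpower t (x + y - 1) / Gamma (x + y)).
assert (Hk : 0 < k) by (apply Rdiv_lt_0_compat; auto; apply Rpower_pos).
replace (Rpower t (x + y - 1) * (Gamma x * Gamma y / Gamma (x + y)))
  with (k * (Gamma x * Gamma y)) by (unfold k; field; lra).
apply sup_integral_ext with (fun tau => k * (dphi tau * g (phi tau))); auto.
{ intros tau H. unfold k, g, dphi, phi, beta_integrand.
  replace (1 + tau / (t - tau)) with (t * / (t - tau)) by (field; lra).
  replace (t / (t - tau) ^ 2) with (Rpower t 1 * Rpower (/ (t - tau)) 2).
  2:{ rewrite Rpower_1 by lra. replace 2 with (INR 2) by (simpl; lra).
      rewrite Rpower_pow by (apply Rinv_0_lt_compat; lra). field. lra. }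
  assert (Hi : 0 < / (t - tau)) by (apply Rinv_0_lt_compat; lra).
  unfold Rdiv. rewrite !Rpower_mult_base by lra.
  set (q := / (t - tau)) in *.
  replace (Rpower (t - tau) (y - 1)) with (Rpower q (1 - y)).
  2:{ unfold q, Rpower. rewrite ln_Rinv by lra. f_equal. ring. }
  transitivity (Rpower tau (x - 1) * (Rpower t (x + y - 1) * Rpower t 1 * Rpower t (- (x + y)))
     * (Rpower q 2 * Rpower q (x - 1) * Rpower q (- (x + y)))).
  - field. lra.
  - rewrite <- !Rpower_plus.
    replace (x + y - 1 + 1 + - (x + y)) with 0 by ring. rewrite Rpower_O by lra.
    replace (2 + (x - 1) + - (x + y)) with (1 - y) by ring. ring. }
apply (sup_integral_scal _ (fun tau => dphi tau * g (phi tau))); auto.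
{ intros tau H. apply (continuous_mult dphi (fun tau => g (phi tau))); auto.
  apply (continuous_comp phi g); auto.
  apply (ex_derive_continuous phi). eexists. now apply Hdd. }
(* The inverse map is [t v / (1 + v)], written as [t - t / (1 + v)] so that its monotonicity is
   visible. *)
apply (sup_integral_subst (fun tau => 0 < tau < t) (fun v => 0 < v) g phi dphi
         (fun v => t - t / (1 + v))); auto.
- intros a b Ha Hb Hab. unfold phi, Rdiv. apply Rmult_le_compat; try lra.
  + left. apply Rinv_0_lt_compat. lra.
  + apply Rinv_le_contravar; lra.
- intros v Hv. assert (Hq : 0 < t / (1 + v) < t).
  { split; [apply Rdiv_lt_0_compat; lra|]. apply Rmult_lt_reg_r with (1 + v); [lra|].
    replace (t / (1 + v) * (1 + v)) with t by (field; lra).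
    assert (0 < t * v) by (apply Rmult_lt_0_compat; lra). lra. }
  split; [lra|]. unfold phi. field. split; lra.
- intros a b Ha Hb Hab. assert (t / (1 + b) <= t / (1 + a)); [|lra].
  apply Rmult_le_compat_l; [lra|]. apply Rinv_le_contravar; lra.
- now apply Gamma_product_sup.
Qed.

Lemma Beta_RInt_gen x y t : 0 < x -> 0 < y -> 0 < t ->
  is_RInt_gen (beta_integrand x y t) (at_right 0) (at_left t)
    (Rpower t (x + y - 1) * (Gamma x * Gamma y / Gamma (x + y))).
Proof.
intros Hx Hy Ht. apply (sup_integral_RInt_gen (fun tau => 0 < tau < t)).
- now apply bounded_ends.
- apply at_right_proper_filter.
- apply at_left_proper_filter.
- apply beta_integrand_continuous.
- intros. left. apply Rmult_lt_0_compat; apply Rpower_pos.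
- now apply Beta_sup.
Qed.

(** * The stretched Caputo operator on power series *)

(** The factor in the Caputo derivative of [t^s]; [r_n] is its value at [s = c n]. *)
Definition gamma_ratio (alpha s : R) : R := Gamma (1 + s) / Gamma (1 + s - alpha).

Lemma gamma_ratio_pos alpha s : 0 < alpha < 1 -> 0 < s -> 0 < gamma_ratio alpha s.
Proof. intros. apply Rdiv_lt_0_compat; apply Gamma_pos; lra. Qed.

Lemma Beta_gamma_ratio alpha s : 0 < alpha < 1 -> 0 < s ->
  s * (Gamma s * Gamma (1 - alpha) / Gamma (s + (1 - alpha))) =
  Gamma (1 - alpha) * gamma_ratio alpha s.
Proof.
intros Ha Hs. unfold gamma_ratio.
replace (1 + s) with (s + 1) by ring. rewrite Gamma_succ by auto.
replace (s + 1 - alpha) with (s + (1 - alpha)) by ring.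
assert (0 < Gamma (s + (1 - alpha))) by (apply Gamma_pos; lra). field. lra.
Qed.

(** Only the part of the Beta integral over [[a, b]] is kept. There the singular factor is at least
    [(1 - a)^(-alpha)], and [s w^(s-1)] integrates to [b^s - a^s]. *)
Lemma gamma_ratio_lower alpha s a : 0 < alpha < 1 -> 0 < s -> 0 < a < 1 ->
  Rpower a s <= 1 / 4 ->
  Rpower (1 - a) (- alpha) / 2 <= Gamma (1 - alpha) * gamma_ratio alpha s.
Proof.
intros Hal Hs Ha H4. rewrite <- Beta_gamma_ratio by auto.
(* Chosen so that [b^s = 3/4]; with [a^s <= 1/4] the difference is at least [1/2]. *)
set (b := Rpower (3 / 4) (/ s)).
assert (Hbs : Rpower b s = 3 / 4).
{ unfold b. rewrite Rpower_mult, Rinv_l, Rpower_1; lra. }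
assert (Hb : 0 < b < 1).
{ split; [apply Rpower_pos|]. unfold b. rewrite <- (Rpower_O (3 / 4)) by lra.
  unfold Rpower. apply exp_increasing.
  assert (ln (3 / 4) < 0) by (rewrite <- ln_1; apply ln_increasing; lra).
  assert (0 < / s) by (apply Rinv_0_lt_compat; lra).
  assert (0 < / s * - ln (3 / 4)) by (apply Rmult_lt_0_compat; lra). lra. }
assert (Hab : a <= b).
{ apply Rnot_lt_le. intros Hl.
  assert (Rpower b s < Rpower a s) by (apply Rlt_Rpower_l; lra). lra. }
destruct (Beta_sup s (1 - alpha) 1 Hs ltac:(lra) ltac:(lra)) as [HB _].
specialize (HB a b Ha Hb Hab).
replace (Rpower 1 (s + (1 - alpha) - 1)) with 1 in HB.
2:{ unfold Rpower. rewrite ln_1, Rmult_0_r, exp_0. reflexivity. }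
rewrite Rmult_1_l in HB.
set (K := Rpower (1 - a) (- alpha)). assert (HK : 0 < K) by apply Rpower_pos.
assert (HI : is_RInt (fun w => K / s * (s * Rpower w (s - 1))) a b (K / s * (Rpower b s - Rpower a s))).
{ apply (is_RInt_scal (V := R_NormedModule) (fun w => s * Rpower w (s - 1)) a b (K / s)).
  apply (is_RInt_derive (V := R_CompleteNormedModule) (fun w => Rpower w s));
  rewrite Rmin_left, Rmax_right by lra; intros x Hx.
  - apply is_derive_Rpower. lra.
  - apply (continuous_scal_r s (fun w => Rpower w (s - 1))). apply continuous_Rpower. lra. }
assert (HJ : K / s * (Rpower b s - Rpower a s) <= RInt (beta_integrand s (1 - alpha) 1) a b).
{ apply (is_RInt_le (fun w => K / s * (s * Rpower w (s - 1))) (beta_integrand s (1 - alpha) 1) a b); auto.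
  - apply (@RInt_correct R_CompleteNormedModule).
    apply (ex_RInt_interval (fun x => 0 < x < 1)); auto.
    + apply (ie_interval _ _ _ (bounded_ends 1 Rlt_0_1)).
    + apply beta_integrand_continuous.
  - intros x Hx. unfold beta_integrand. assert (Hp := Rpower_pos x (s - 1)).
    replace (K / s * (s * Rpower x (s - 1))) with (Rpower x (s - 1) * K) by (field; lra).
    apply Rmult_le_compat_l; [lra|]. unfold K.
    replace (1 - alpha - 1) with (- alpha) by ring. rewrite !Rpower_Ropp.
    apply Rinv_le_contravar; [apply Rpower_pos|]. apply Rle_Rpower_l; lra. }
set (B := Gamma s * Gamma (1 - alpha) / Gamma (s + (1 - alpha))) in *.
assert (H2 : K / s * (1 / 2) <= B).
{ apply Rle_trans with (K / s * (Rpower b s - Rpower a s)); [|lra].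
  apply Rmult_le_compat_l; [left; now apply Rdiv_lt_0_compat | lra]. }
apply (Rmult_le_compat_l s) in H2; [|lra].
replace (s * (K / s * (1 / 2))) with (K / 2) in H2 by (field; lra). exact H2.
Qed.

(** For fixed [a] below 1, [a^(c (n + 1))] is geometric and drops below [1/4]; from then on the
    lower bound applies, and it is as large as desired when [a] is close to 1. *)
Lemma is_lim_seq_inv_gamma_ratio alpha c : 0 < alpha < 1 -> 0 < c ->
  is_lim_seq (fun n => / gamma_ratio alpha (c * INR (S n))) 0.
Proof.
intros Ha Hc. assert (HG : 0 < Gamma (1 - alpha)) by (apply Gamma_pos; lra).
apply is_lim_seq_spec. intros eps. assert (He := cond_pos eps).
(* The factor 4 gives a ratio of at least [2 / eps], hence strictly above [1 / eps]. *)
set (X := 4 * Gamma (1 - alpha) / eps).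
assert (HX : 0 < X) by (apply Rdiv_lt_0_compat; lra).
(* [h] is [1 - a]: the second bound forces [h^(-alpha) >= X], and the first keeps [a] inside
   [(0, 1)]. *)
set (h := Rmin (1 / 2) (Rpower X (- / alpha))).
assert (Hh : 0 < h <= 1 / 2).
{ split; [apply Rmin_pos; [lra | apply Rpower_pos] | apply Rmin_l]. }
assert (HhX : X <= Rpower h (- alpha)).
{ rewrite Rpower_Ropp.
  rewrite <- (Rinv_inv X). apply Rinv_le_contravar; [apply Rpower_pos|].
  apply Rle_trans with (Rpower (Rpower X (- / alpha)) alpha).
  - apply Rle_Rpower_l; [lra|]. split; [lra | apply Rmin_r].
  - rewrite Rpower_mult. replace (- / alpha * alpha) with (- (1)) by (field; lra).
    rewrite Rpower_Ropp, Rpower_1 by auto. lra. }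
set (a := 1 - h). set (q := Rpower a c).
assert (Hq : 0 < q < 1).
{ split; [apply Rpower_pos|]. unfold q. rewrite <- (Rpower_O a) by (unfold a; lra).
  unfold Rpower. apply exp_increasing.
  assert (ln a < 0) by (rewrite <- ln_1; apply ln_increasing; unfold a; lra).
  assert (0 < c * - ln a) by (apply Rmult_lt_0_compat; lra). lra. }
destruct (pow_lt_1_zero q ltac:(rewrite Rabs_pos_eq; lra) (1 / 4) ltac:(lra)) as [N HN].
exists N. intros n Hn. rewrite Rminus_0_r.
assert (Hs : 0 < c * INR (S n)) by (apply Rmult_lt_0_compat; auto; apply lt_0_INR; lia).
assert (Hr := gamma_ratio_pos alpha _ Ha Hs).
rewrite Rabs_pos_eq by (left; now apply Rinv_0_lt_compat).
assert (Hpa : Rpower a (c * INR (S n)) <= 1 / 4).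
{ rewrite <- Rpower_mult, Rpower_pow by apply Rpower_pos.
  specialize (HN (S n) ltac:(lia)). fold q. apply Rabs_def2 in HN. lra. }
assert (HL := gamma_ratio_lower alpha _ a Ha Hs ltac:(unfold a; lra) Hpa).
replace (1 - a) with h in HL by (unfold a; ring).
assert (H1 : X / 2 <= Gamma (1 - alpha) * gamma_ratio alpha (c * INR (S n))) by lra.
set (r := gamma_ratio alpha (c * INR (S n))) in *.
assert (H2 : 2 / eps <= r).
{ apply Rmult_le_reg_l with (Gamma (1 - alpha)); auto.
  replace (Gamma (1 - alpha) * (2 / eps)) with (X / 2) by (unfold X; field; lra). auto. }
assert (0 < / eps) by now apply Rinv_0_lt_compat.
rewrite <- (Rinv_inv eps). apply Rinv_lt_contravar.
- now apply Rmult_lt_0_compat.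
- unfold Rdiv in H2. lra.
Qed.

Lemma Rpower_mult_INR t c n : Rpower t (c * INR n) = Rpower t c ^ n.
Proof. rewrite <- Rpower_mult. apply Rpower_pow, Rpower_pos. Qed.

Lemma CV_radius_infinite (u : nat -> R) :
  (forall x, 0 < x -> ex_series (fun n => u n * x ^ n)) -> CV_radius u = p_infty.
Proof.
intros H. assert (H0 := CV_radius_ge_0 u).
destruct (CV_radius u) as [r| |] eqn:E; auto; [|easy].
simpl in H0. exfalso.
apply (CV_disk_outside u (r + 1)).
- rewrite E. simpl. rewrite Rabs_pos_eq; lra.
- apply ex_series_lim_0. apply H. lra.
Qed.

(** Every positive [x] is [t^c] for [t = x^(1/c)], so convergence for all positive [t] excludes a
    finite radius. *)
Lemma stretched_power_series_entire c (u : nat -> R) f : 0 < c ->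
  (forall t, 0 < t -> is_series (fun n => u n * Rpower t (c * INR n)) (f t)) ->
  CV_radius u = p_infty /\ forall t, 0 < t -> f t = PSeries u (Rpower t c).
Proof.
intros Hc H. split.
- apply CV_radius_infinite. intros x Hx. exists (f (Rpower x (/ c))).
  eapply is_series_ext; [|apply H, Rpower_pos].
  intros n; simpl. rewrite Rpower_mult_INR, Rpower_mult, Rinv_l, Rpower_1; auto; lra.
- intros t Ht. symmetry. apply is_series_unique.
  eapply is_series_ext; [|apply H, Ht].
  intros n; simpl. now rewrite Rpower_mult_INR.
Qed.

Lemma is_lim_seq_series_tail (u : nat -> R) : ex_series u ->
  is_lim_seq (fun N => Series (fun k => u (S N + k)%nat)) 0.
Proof.
intros Hu. apply is_lim_seq_ext with (fun N => Series u - sum_n u N).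
- intros N. rewrite (Series_incr_n u (S N) ltac:(lia) Hu), sum_n_Reals. simpl pred. ring.
- replace (Finite 0) with (Rbar_minus (Series u) (Series u)) by (simpl; f_equal; ring).
  apply is_lim_seq_minus'; [apply is_lim_seq_const | now apply Series_correct].
Qed.

(** The bound does not depend on [x], so it can be taken out of an integral over [tau]. *)
Lemma PSeries_tail_bound (d : nat -> R) x X N : CV_radius d = p_infty -> 0 <= x <= X ->
  Rabs (PSeries d x - sum_n (fun n => d n * x ^ n) N) <=
  Series (fun k => Rabs (d (S N + k)%nat * X ^ (S N + k))).
Proof.
intros Hd Hx.
assert (Hex : forall y, ex_series (fun n => Rabs (d n * y ^ n))).
{ intros y. apply CV_disk_inside. now rewrite Hd. }
unfold PSeries.
rewrite (Series_incr_n (fun n => d n * x ^ n) (S N)), sum_n_Reals; try lia.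
2:{ apply ex_series_Rabs. apply Hex. }
simpl pred.
match goal with |- Rabs ?e <= _ =>
  replace e with (Series (fun k => d (S N + k)%nat * x ^ (S N + k))) by ring end.
apply Rle_trans with (Series (fun k => Rabs (d (S N + k)%nat * x ^ (S N + k)))).
- apply Series_Rabs. now apply (ex_series_incr_n (fun n => Rabs (d n * x ^ n))).
- apply Series_le.
  + intros n. split; [apply Rabs_pos|]. rewrite !Rabs_mult.
    apply Rmult_le_compat_l; [apply Rabs_pos|].
    rewrite !Rabs_pos_eq by (apply pow_le; lra). now apply pow_incr.
  + now apply (ex_series_incr_n (fun n => Rabs (d n * X ^ n))).
Qed.

(* Termwise integration: the remainder of the differentiated series is bounded
   by [eps_N * tau^(c-1) (t-tau)^(-alpha)], which is integrable. *)
Lemma caputo_power_series alpha c (u : nat -> R) f t V :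
  0 < alpha < 1 -> 0 < c -> 0 < t -> CV_radius u = p_infty ->
  (forall tau, 0 < tau -> f tau = PSeries u (Rpower tau c)) ->
  is_RInt_gen (fun tau => Derive f tau * Rpower (t - tau) (- alpha))
    (at_right 0) (at_left t) V ->
  is_series (fun n => u (S n) * (Gamma (1 - alpha) * gamma_ratio alpha (c * INR (S n)))
                        * Rpower t (c * INR (S n) - alpha)) V.
Proof.
intros Ha Hc Ht Hu Hf HV.
set (d := PS_derive u).
assert (Hd : CV_radius d = p_infty) by (unfold d; now rewrite CV_radius_derive).
(* Differentiation removes the constant term, so index [n] of [d] belongs to the power
   [tau^(c (n + 1))] of the original series. *)
set (s := fun n => c * INR (S n)).
assert (Hs : forall n, 0 < s n).
{ intros n. apply Rmult_lt_0_compat; auto. apply lt_0_INR; lia. }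
set (B := fun n => Rpower t (s n + (1 - alpha) - 1) *
   (Gamma (s n) * Gamma (1 - alpha) / Gamma (s n + (1 - alpha)))).
set (w := fun n tau => d n * c * beta_integrand (s n) (1 - alpha) t tau).
set (J := fun n => d n * c * B n).
assert (HJ : forall n, is_RInt_gen (w n) (at_right 0) (at_left t) (J n)).
{ intros n.
  apply (is_RInt_gen_scal (V := R_NormedModule) (beta_integrand (s n) (1 - alpha) t) (d n * c)).
  apply Beta_RInt_gen; auto; lra. }
assert (HS : forall N, is_RInt_gen (fun tau => sum_n (fun n => w n tau) N)
   (at_right 0) (at_left t) (sum_n J N)).
{ induction N.
  - rewrite sum_O. apply is_RInt_gen_ext with (w O); auto.
    apply filter_forall. intros ab x _. now rewrite sum_O.
  - rewrite sum_Sn. apply is_RInt_gen_ext with (fun tau => plus (sum_n (fun n => w n tau) N) (w (S N) tau)).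
    + apply filter_forall. intros ab x _. now rewrite sum_Sn.
    + now apply (is_RInt_gen_plus (V := R_NormedModule)). }
apply is_series_ext with J.
{ intros n. unfold J, B. rewrite <- Beta_gamma_ratio by (auto; apply Hs).
  unfold s, d, PS_derive.
  replace (c * INR (S n) + (1 - alpha) - 1) with (c * INR (S n) - alpha) by ring. real_eq. ring. }
assert (HDf : forall tau, 0 < tau ->
  Derive f tau = c * Rpower tau (c - 1) * PSeries d (Rpower tau c)).
{ intros tau Htau. apply is_derive_unique.
  apply (is_derive_ext_loc (fun tau => PSeries u (Rpower tau c))).
  - generalize (open_gt 0 tau Htau). apply filter_imp. intros y Hy. symmetry. now apply Hf.
  - apply (is_derive_comp (V := R_NormedModule) (PSeries u) (fun tau => Rpower tau c)).
    + apply is_derive_PSeries. now rewrite Hu.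
    + now apply is_derive_Rpower. }
set (X := Rpower t c).
set (eps := fun N => Series (fun k => Rabs (d (S N + k)%nat * X ^ (S N + k)))).
assert (Hw : forall N tau, sum_n (fun n => w n tau) N =
   c * Rpower tau (c - 1) * Rpower (t - tau) (- alpha) * sum_n (fun n => d n * Rpower tau c ^ n) N).
{ intros N tau. rewrite <- (sum_n_mult_l (K := R_Ring) _ _ N).
  apply sum_n_ext. intros n. unfold w, beta_integrand, s, mult; simpl mult.
  replace (1 - alpha - 1) with (- alpha) by ring.
  rewrite <- Rpower_mult_INR, S_INR.
  replace (c * (INR n + 1) - 1) with (c - 1 + c * INR n) by ring.
  rewrite Rpower_plus. simpl. ring. }
(* The factor common to all terms, [c tau^(c-1) (t - tau)^(-alpha)], is [c] times the Beta integrand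
   at [s O = c], whence [c * B O]. *)
assert (Hineq : forall N, Rabs (V - sum_n J N) <= eps N * (c * B O)).
{ intros N.
  apply (RInt_gen_norm (V := R_CompleteNormedModule) (Fa := at_right 0) (Fb := at_left t)
     (fun tau => minus (Derive f tau * Rpower (t - tau) (- alpha)) (sum_n (fun n => w n tau) N))
     (fun tau => eps N * (c * beta_integrand (s O) (1 - alpha) t tau)) (V - sum_n J N)).
  - exists (fun x => 0 < x < t /\ x <= t / 2) (fun x => 0 < x < t /\ t / 2 <= x).
    + apply (ie_left _ _ _ (bounded_ends t Ht)). lra.
    + apply (ie_right _ _ _ (bounded_ends t Ht)). lra.
    + intros x y Hx Hy. simpl. lra.
  - exists (fun x => 0 < x < t /\ x <= t / 2) (fun x => 0 < x < t /\ t / 2 <= x).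
    + apply (ie_left _ _ _ (bounded_ends t Ht)). lra.
    + apply (ie_right _ _ _ (bounded_ends t Ht)). lra.
    + intros x y Hx Hy z Hz. simpl in Hz. rewrite Hw, HDf by lra.
      set (W := c * Rpower z (c - 1) * Rpower (t - z) (- alpha)).
      change (Rabs (c * Rpower z (c - 1) * PSeries d (Rpower z c) * Rpower (t - z) (- alpha)
         - W * sum_n (fun n => d n * Rpower z c ^ n) N)
         <= eps N * (c * beta_integrand (s O) (1 - alpha) t z)).
      replace (c * beta_integrand (s O) (1 - alpha) t z) with W.
      2:{ unfold W, beta_integrand, s. simpl INR. rewrite Rmult_1_r.
          replace (1 - alpha - 1) with (- alpha) by ring. ring. }
      assert (HW : 0 < W) by (repeat apply Rmult_lt_0_compat; auto; apply Rpower_pos).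
      replace (c * Rpower z (c - 1) * PSeries d (Rpower z c) * Rpower (t - z) (- alpha)
         - W * sum_n (fun n => d n * Rpower z c ^ n) N)
        with (W * (PSeries d (Rpower z c) - sum_n (fun n => d n * Rpower z c ^ n) N))
        by (unfold W; ring).
      rewrite Rabs_mult, (Rabs_pos_eq W) by lra. rewrite Rmult_comm.
      apply Rmult_le_compat_r; [lra|]. apply PSeries_tail_bound; auto.
      split; [left; apply Rpower_pos|]. apply Rle_Rpower_l; lra.
  - apply (is_RInt_gen_minus (V := R_NormedModule)); auto.
  - apply (is_RInt_gen_scal (V := R_NormedModule)
             (fun tau => c * beta_integrand (s O) (1 - alpha) t tau) (eps N)).
    apply (is_RInt_gen_scal (V := R_NormedModule) (beta_integrand (s O) (1 - alpha) t) c).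
    apply Beta_RInt_gen; auto; lra. }
assert (Heps : is_lim_seq eps 0).
{ apply (is_lim_seq_series_tail (fun n => Rabs (d n * X ^ n))).
  apply CV_disk_inside. now rewrite Hd. }
assert (Hlim : is_lim_seq (fun N => V - sum_n J N) 0).
{ apply is_lim_seq_abs_0.
  apply is_lim_seq_le_le with (fun _ => 0) (fun N => eps N * (c * B O)).
  - intros N. split; [apply Rabs_pos | apply Hineq].
  - apply is_lim_seq_const.
  - replace (Finite 0) with (Rbar_mult 0 (c * B O)) by (simpl; f_equal; ring).
    now apply is_lim_seq_scal_r. }
change (is_lim_seq (sum_n J) V).
apply is_lim_seq_ext with (fun N => V - (V - sum_n J N)). { intros; ring. }
replace (Finite V) with (Finite (V - 0)) by (f_equal; ring).
apply is_lim_seq_minus'; auto. apply is_lim_seq_const.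
Qed.

(** The Caputo derivative lowers exponents by [alpha] and the factor [t^(-gamma)] by [gamma],
    together by exactly one step [c]. The result has the form of the hypothesis, so the lemma can be
    iterated. *)
Lemma stretched_deriv_power_series alpha gamma (u : nat -> R) f g :
  0 < alpha < 1 -> 0 < alpha + gamma ->
  (forall t, 0 < t -> is_series (fun n => u n * Rpower t ((alpha + gamma) * INR n)) (f t)) ->
  stretched_deriv alpha gamma f g ->
  forall t, 0 < t -> is_series (fun n =>
    (gamma_ratio alpha ((alpha + gamma) * INR (S n)) * u (S n))
      * Rpower t ((alpha + gamma) * INR n)) (g t).
Proof.
intros Ha Hc Hu Hg t Ht. set (c := alpha + gamma) in *.
destruct (stretched_power_series_entire c u f Hc Hu) as [Hr Hf].
destruct (Hg t Ht) as [_ HI].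
assert (HS := caputo_power_series alpha c u f t _ Ha Hc Ht Hr Hf HI).
assert (HG : 0 < Gamma (1 - alpha)) by (apply Gamma_pos; lra).
assert (Hp := Rpower_pos t gamma).
apply (is_series_scal (/ (Gamma (1 - alpha) * Rpower t gamma))) in HS.
replace (g t) with (/ (Gamma (1 - alpha) * Rpower t gamma) *
  (Gamma (1 - alpha) * (Rpower t gamma * g t))) by (field; lra).
eapply is_series_ext; [|exact HS]. intros n.
change (/ (Gamma (1 - alpha) * Rpower t gamma) *
  (u (S n) * (Gamma (1 - alpha) * gamma_ratio alpha (c * INR (S n)))
     * Rpower t (c * INR (S n) - alpha)) =
  gamma_ratio alpha (c * INR (S n)) * u (S n) * Rpower t (c * INR n)).
replace (c * INR (S n) - alpha) with (c * INR n + gamma)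
  by (rewrite S_INR; unfold c; ring).
rewrite Rpower_plus. field. lra.
Qed.

(** * Kilbas-Saigo series and the recurrence *)

(** Values at [t^c] concern positive [x] only. Continuity at 0 still yields the constant
    coefficient, and division by [x] passes to the shifted series. *)
Lemma PSeries_eq_0_coef (u : nat -> R) : CV_radius u = p_infty ->
  (forall x, 0 < x -> PSeries u x = 0) -> forall n, u n = 0.
Proof.
intros Hu H n. revert u Hu H.
assert (H0 : forall u, CV_radius u = p_infty -> (forall x, 0 < x -> PSeries u x = 0) -> u O = 0).
{ intros u Hu H. destruct (Req_dec (u O) 0) as [|Hn]; auto. exfalso.
  assert (Hc : continuity_pt (PSeries u) 0).
  { apply continuity_pt_filterlim, (ex_derive_continuous (PSeries u)).
    apply ex_derive_PSeries. now rewrite Hu. }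
  apply continuity_pt_filterlim in Hc.
  assert (Hp : 0 < Rabs (u O)) by now apply Rabs_pos_lt.
  apply filterlim_locally with (eps := mkposreal _ Hp) in Hc.
  destruct Hc as [delta Hd]. assert (Hdp := cond_pos delta).
  specialize (Hd (delta / 2)). change (Rabs (delta / 2 - 0) < delta ->
    Rabs (PSeries u (delta / 2) - PSeries u 0) < Rabs (u O)) in Hd.
  rewrite PSeries_0, H in Hd by lra. rewrite Rminus_0_l, Rabs_Ropp in Hd.
  rewrite Rminus_0_r, Rabs_pos_eq in Hd by lra. specialize (Hd ltac:(lra)). lra. }
induction n; intros u Hu H; auto.
apply (IHn (PS_decr_1 u)).
- now rewrite CV_radius_decr_1.
- intros x Hx. assert (E := PSeries_decr_1 u x ltac:(apply CV_radius_inside; now rewrite Hu)).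
  rewrite H, H0 in E by auto. apply Rmult_eq_reg_l with x; lra.
Qed.

Section KilbasSaigo.

Variables alpha gamma : R.
Hypothesis Halpha : 0 < alpha < 1.
Hypothesis Hgamma : 0 < alpha + gamma.

Let e := KS_coef alpha (1 + gamma / alpha) (gamma / alpha).
Let rho n := gamma_ratio alpha ((alpha + gamma) * INR (S n)).

Lemma gamma_ratio_step_pos n : 0 < rho n.
Proof.
apply gamma_ratio_pos; auto. apply Rmult_lt_0_compat; auto. apply lt_0_INR. lia.
Qed.

(** The parameters [m] and [l] are those for which [alpha * (n * m + l) = (alpha + gamma) * (n + 1)
    - alpha]. *)
Lemma KS_coef_succ n : e (S n) = e n / rho n.
Proof.
unfold e, rho, gamma_ratio. cbn [KS_coef]. rewrite S_INR.
replace (1 + alpha * (INR n * (1 + gamma / alpha) + gamma / alpha))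
  with (1 + (alpha + gamma) * (INR n + 1) - alpha) by (field; lra).
replace (1 + alpha * (INR n * (1 + gamma / alpha) + gamma / alpha + 1))
  with (1 + (alpha + gamma) * (INR n + 1)) by (field; lra).
assert (0 < (alpha + gamma) * (INR n + 1)).
{ apply Rmult_lt_0_compat; auto. assert (H := pos_INR n). lra. }
assert (0 < Gamma (1 + (alpha + gamma) * (INR n + 1))) by (apply Gamma_pos; lra).
assert (0 < Gamma (1 + (alpha + gamma) * (INR n + 1) - alpha)) by (apply Gamma_pos; lra).
field. lra.
Qed.

Lemma KS_coef_pos n : 0 < e n.
Proof.
induction n.
- apply Rlt_0_1.
- rewrite KS_coef_succ. apply Rdiv_lt_0_compat; auto. apply gamma_ratio_step_pos.
Qed.

Lemma KS_coef_entire : CV_radius e = p_infty.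
Proof.
apply CV_radius_infinite_DAlembert.
- intros n. apply Rgt_not_eq, KS_coef_pos.
- apply is_lim_seq_ext with (fun n => / rho n).
  + intros n. rewrite KS_coef_succ. assert (Hr := gamma_ratio_step_pos n).
    assert (He := KS_coef_pos n).
    replace (e n / rho n / e n) with (/ rho n) by (field; lra).
    rewrite Rabs_pos_eq; auto. left. now apply Rinv_0_lt_compat.
  + now apply is_lim_seq_inv_gamma_ratio.
Qed.

(** Intended for [p n] the real or imaginary part of the [n]-th power of a complex number of modulus
    [x]. *)
Lemma ex_series_KS_coef (p : nat -> R) x :
  (forall n, Rabs (p n) <= x ^ n) -> ex_series (fun n => e n * p n).
Proof.
intros Hp. apply (ex_series_le (V := R_CompleteNormedModule) _ (fun n => Rabs (e n * x ^ n))).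
- intros n. change (Rabs (e n * p n) <= Rabs (e n * x ^ n)). rewrite !Rabs_mult.
  apply Rmult_le_compat_l; [apply Rabs_pos|].
  apply Rle_trans with (1 := Hp n), Rle_abs.
- apply CV_disk_inside. now rewrite KS_coef_entire.
Qed.

Lemma KS_E_series x : is_series (fun n => e n * x ^ n) (KS_E alpha (1 + gamma / alpha) (gamma / alpha) x).
Proof.
apply Series_correct. apply ex_series_Rabs, CV_disk_inside. now rewrite KS_coef_entire.
Qed.

(** The factor [x] undoes the index shift of the derivative, so this series can be added termwise to
    that of [KS_E]. *)
Lemma KS_E1_series x : is_series (fun n => e n * (INR n * x ^ n))
  (x * KS_E1 alpha (1 + gamma / alpha) (gamma / alpha) x).
Proof.
unfold KS_E1, KS_E. fold e.
assert (H := is_pseries_derive e x ltac:(now rewrite KS_coef_entire)).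
apply is_pseries_R in H. apply (is_series_scal x) in H.
apply is_series_decr_1.
match goal with |- is_series _ ?l => replace l with (x * Derive (PSeries e) x) end.
- eapply is_series_ext; [|exact H]. intros n.
  change (x * (PS_derive e n * x ^ n) = e (S n) * (INR (S n) * x ^ S n)).
  unfold PS_derive. simpl pow. ring.
- change (x * Derive (PSeries e) x = x * Derive (PSeries e) x + - (e O * (0 * 1))). ring.
Qed.

(** [lim] is meaningful only on Cauchy filters. Componentwise convergence shows that the partial
    sums form one, and uniqueness of limits then gives the value. *)
Lemma KS_EC_series (z : C) :
  KS_EC alpha (1 + gamma / alpha) (gamma / alpha) z =
  (Series (fun n => e n * Re (pow_n z n)), Series (fun n => e n * Im (pow_n z n))).
Proof.
assert (Hm : forall n, Cmod (pow_n z n) <= Cmod z ^ n).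
{ induction n.
  - change (Cmod 1 <= 1). rewrite Cmod_1. lra.
  - change (Cmod (Cmult z (pow_n z n)) <= Cmod z * Cmod z ^ n). rewrite Cmod_mult.
    apply Rmult_le_compat_l; auto. apply Cmod_ge_0. }
assert (HRe : ex_series (fun n => e n * Re (pow_n z n))).
{ apply ex_series_KS_coef with (Cmod z). intros n.
  apply Rle_trans with (2 := Hm n). apply Rle_trans with (2 := Rmax_Cmod _). apply Rmax_l. }
assert (HIm : ex_series (fun n => e n * Im (pow_n z n))).
{ apply ex_series_KS_coef with (Cmod z). intros n.
  apply Rle_trans with (2 := Hm n). apply Rle_trans with (2 := Rmax_Cmod _). apply Rmax_r. }
apply Series_correct in HRe. apply Series_correct in HIm.
set (L1 := Series (fun n => e n * Re (pow_n z n))) in *.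
set (L2 := Series (fun n => e n * Im (pow_n z n))) in *.
set (w := fun n => Cmult (RtoC (e n)) (pow_n z n)).
assert (Hsum : forall N, sum_n w N =
  (sum_n (fun n => e n * Re (pow_n z n)) N, sum_n (fun n => e n * Im (pow_n z n)) N)).
{ assert (Hw : forall n, w n = (e n * Re (pow_n z n), e n * Im (pow_n z n))).
  { intros n. unfold w. destruct (pow_n z n) as [x y].
    apply injective_projections; simpl; ring. }
  induction N.
  - rewrite !sum_O. apply Hw.
  - rewrite !sum_Sn, IHN, Hw. reflexivity. }
set (F := filtermap (sum_n w) eventually).
assert (HF : ProperFilter F) by (apply filtermap_proper_filter, eventually_filter).
assert (HL : forall eps : posreal, F (@ball C_CompleteNormedModule ((L1, L2) : C) eps)).
{ intros eps.
  assert (H1 := proj1 (filterlim_locally _ _) HRe eps).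
  assert (H2 := proj1 (filterlim_locally _ _) HIm eps).
  change (eventually (fun N => @ball C_CompleteNormedModule ((L1, L2) : C) eps (sum_n w N))).
  generalize (filter_and _ _ H1 H2). apply filter_imp. intros N [B1 B2].
  rewrite Hsum. split; assumption. }
assert (Hlim : forall eps : posreal, F (@ball C_CompleteNormedModule (@lim C_CompleteNormedModule F) eps)).
{ apply (@complete_cauchy C_CompleteNormedModule F HF). intros eps. exists ((L1, L2) : C). apply HL. }
apply (@is_filter_lim_unique _ C_CompleteNormedModule F).
- now apply Proper_StrongProper.
- intros P [eps HP]. eapply filter_imp; [exact HP | apply Hlim].
- intros P [eps HP]. eapply filter_imp; [exact HP | apply HL].
Qed.

(** * The recurrence for a solution and its three root cases *)

Variables (a b : R) (u : nat -> R) (f : R -> R).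
Hypothesis Hf : forall t, 0 < t ->
  is_series (fun n => u n * Rpower t ((alpha + gamma) * INR n)) (f t).
Hypothesis Hsol : exists g1 g2 : R -> R,
  stretched_deriv alpha gamma f g1 /\ stretched_deriv alpha gamma g1 g2 /\
  forall t, 0 < t -> g2 t + a * g1 t + b * f t = 0.

Lemma coefficient_recurrence : exists v : nat -> R,
  (forall n, v (S (S n)) + a * v (S n) + b * v n = 0) /\
  forall t, 0 < t ->
    is_series (fun n => e n * (v n * Rpower t (alpha + gamma) ^ n)) (f t).
Proof.
destruct Hsol as (g1 & g2 & H1 & H2 & H).
assert (G1 := stretched_deriv_power_series alpha gamma u f g1 Halpha Hgamma Hf H1).
assert (G2 := stretched_deriv_power_series alpha gamma _ g1 g2 Halpha Hgamma G1 H2).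
set (c := alpha + gamma) in *.
set (k := fun n => rho n * (rho (S n) * u (S (S n))) + a * (rho n * u (S n)) + b * u n).
assert (Hk : forall t, 0 < t -> is_series (fun n => k n * Rpower t (c * INR n)) ((fun _ => 0) t)).
{ intros t Ht. rewrite <- (H t Ht).
  assert (A1 := is_series_scal a _ _ (G1 t Ht)).
  assert (A0 := is_series_scal b _ _ (Hf t Ht)).
  assert (A2 := is_series_plus _ _ _ _ (is_series_plus _ _ _ _ (G2 t Ht) A1) A0).
  eapply is_series_ext; [|exact A2]. intros n.
  change (rho n * (rho (S n) * u (S (S n))) * Rpower t (c * INR n)
    + a * (rho n * u (S n) * Rpower t (c * INR n)) + b * (u n * Rpower t (c * INR n))
    = k n * Rpower t (c * INR n)).
  unfold k. ring. }
destruct (stretched_power_series_entire c k (fun _ => 0) Hgamma Hk) as [Hr Hz].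
assert (Hk0 : forall n, k n = 0).
{ apply PSeries_eq_0_coef; auto. intros x Hx.
  rewrite (Hz (Rpower x (/ c)) (Rpower_pos _ _)). f_equal.
  rewrite Rpower_mult, Rinv_l, Rpower_1; auto. lra. }
exists (fun n => u n / e n). split.
- intros n. specialize (Hk0 n). unfold k in Hk0. rewrite !KS_coef_succ.
  assert (R0 := gamma_ratio_step_pos n). assert (R1 := gamma_ratio_step_pos (S n)).
  assert (E0 := KS_coef_pos n).
  transitivity ((rho n * (rho (S n) * u (S (S n))) + a * (rho n * u (S n)) + b * u n) / e n).
  + field. repeat split; lra.
  + rewrite Hk0. field. lra.
- intros t Ht. eapply is_series_ext; [|exact (Hf t Ht)]. intros n.
  change (u n * Rpower t (c * INR n) = e n * (u n / e n * Rpower t c ^ n)).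
  rewrite Rpower_mult_INR. assert (E0 := KS_coef_pos n). field. lra.
Qed.

Lemma KS_solution_distinct_roots z1 z2 : z1 <> z2 ->
  z1 ^ 2 + a * z1 + b = 0 -> z2 ^ 2 + a * z2 + b = 0 ->
  exists K1 K2, forall t, 0 < t ->
    f t = K1 * KS_E alpha (1 + gamma / alpha) (gamma / alpha) (z1 * Rpower t (alpha + gamma))
        + K2 * KS_E alpha (1 + gamma / alpha) (gamma / alpha) (z2 * Rpower t (alpha + gamma)).
Proof.
intros Hne Hz1 Hz2. destruct coefficient_recurrence as (v & Hv & Hs).
(* The solution of [K1 + K2 = v 0] and [K1 z1 + K2 z2 = v 1]. *)
set (K2 := (v 1%nat - v O * z1) / (z2 - z1)). set (K1 := v O - K2).
exists K1, K2.
assert (E : forall n, v n = K1 * z1 ^ n + K2 * z2 ^ n /\ v (S n) = K1 * z1 ^ S n + K2 * z2 ^ S n).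
{ induction n as [|n [I0 I1]].
  - split; unfold K1, K2; simpl; field; lra.
  - split; auto. specialize (Hv n).
    replace (v (S (S n))) with (- a * v (S n) - b * v n) by lra. rewrite I0, I1. simpl.
    replace (K1 * (z1 * (z1 * z1 ^ n)) + K2 * (z2 * (z2 * z2 ^ n)))
      with (K1 * z1 ^ n * z1 ^ 2 + K2 * z2 ^ n * z2 ^ 2) by ring.
    replace (z1 ^ 2) with (- a * z1 - b) by lra. replace (z2 ^ 2) with (- a * z2 - b) by lra. ring. }
intros t Ht. set (s := Rpower t (alpha + gamma)).
assert (A1 := is_series_scal K1 _ _ (KS_E_series (z1 * s))).
assert (A2 := is_series_scal K2 _ _ (KS_E_series (z2 * s))).
assert (A := is_series_plus _ _ _ _ A1 A2).
rewrite <- (is_series_unique _ _ (Hs t Ht)). apply is_series_unique.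
eapply is_series_ext; [|exact A]. intros n.
change (K1 * (e n * (z1 * s) ^ n) + K2 * (e n * (z2 * s) ^ n) = e n * (v n * s ^ n)).
rewrite (proj1 (E n)), !Rpow_mult_distr. ring.
Qed.

Lemma KS_solution_double_root z : z <> 0 -> a = - 2 * z -> b = z ^ 2 ->
  exists K1 K2, forall t, 0 < t ->
    f t = K1 * KS_E alpha (1 + gamma / alpha) (gamma / alpha) (z * Rpower t (alpha + gamma))
        + K2 * Rpower t (alpha + gamma) *
          KS_E1 alpha (1 + gamma / alpha) (gamma / alpha) (z * Rpower t (alpha + gamma)).
Proof.
intros Hz Ha Hb. destruct coefficient_recurrence as (v & Hv & Hs).
(* [(v 0 + K n) z^n] is fitted at [n = 1], which requires dividing by [z]. *)
set (K := v 1%nat / z - v O).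
(* The sum of [K n e_n (z s)^n] is [K] times [z s] times the derivative at [z s]; the extra [z] goes
   into the constant. *)
exists (v O), (K * z).
assert (E : forall n, v n = (v O + K * INR n) * z ^ n /\ v (S n) = (v O + K * INR (S n)) * z ^ S n).
{ induction n as [|n [I0 I1]].
  - split; unfold K; simpl; field; lra.
  - split; auto. specialize (Hv n).
    replace (v (S (S n))) with (- a * v (S n) - b * v n) by lra.
    rewrite I0, I1, Ha, Hb, !S_INR. simpl. ring. }
intros t Ht. set (s := Rpower t (alpha + gamma)).
assert (A1 := is_series_scal (v O) _ _ (KS_E_series (z * s))).
assert (A2 := is_series_scal K _ _ (KS_E1_series (z * s))).
assert (A := is_series_plus _ _ _ _ A1 A2).
rewrite <- (is_series_unique _ _ (Hs t Ht)). apply is_series_unique.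
match goal with |- is_series _ ?l => match type of A with is_series _ ?l' =>
  replace l with (l' : R) end end.
- eapply is_series_ext; [|exact A]. intros n.
  change (v O * (e n * (z * s) ^ n) + K * (e n * (INR n * (z * s) ^ n)) = e n * (v n * s ^ n)).
  rewrite (proj1 (E n)), !Rpow_mult_distr. ring.
- match goal with |- plus (scal ?x ?y) (scal ?x' ?y') = _ =>
    change (x * y + x' * y' = v O * y + K * z * s * KS_E1 alpha (1 + gamma / alpha) (gamma / alpha) (z * s)) end.
  ring.
Qed.

Lemma KS_solution_complex_roots x y : y <> 0 -> a = - 2 * x -> b = x ^ 2 + y ^ 2 ->
  exists K1 K2 : C, K1 = Cconj K2 /\ forall t, 0 < t ->
    RtoC (f t) =
    Cplus (Cmult K1 (KS_EC alpha (1 + gamma / alpha) (gamma / alpha)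
             (x * Rpower t (alpha + gamma), y * Rpower t (alpha + gamma))))
          (Cmult K2 (KS_EC alpha (1 + gamma / alpha) (gamma / alpha)
             (x * Rpower t (alpha + gamma), - y * Rpower t (alpha + gamma)))).
Proof.
intros Hy Ha Hb. destruct coefficient_recurrence as (v & Hv & Hs).
(* With [K1 = p + i q], the conjugate terms add up to [2 Re (K1 (x + i y)^n)]; matching this with
   [v] at [n = 0] and [n = 1] gives [p] and [q]. *)
set (p := v O / 2). set (q := (2 * p * x - v 1%nat) / (2 * y)).
exists (p, q), (p, - q). split.
{ unfold Cconj. simpl. now rewrite Ropp_involutive. }
intros t Ht. set (s := Rpower t (alpha + gamma)). rewrite !KS_EC_series.
set (z := (x * s, y * s) : C).
set (P := fun n => Re (pow_n z n)). set (Q := fun n => Im (pow_n z n)).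
assert (Hz : forall n, pow_n z (S n) = Cmult z (pow_n z n)) by reflexivity.
assert (Hconj : forall n, pow_n ((x * s, - y * s) : C) n = (P n, - Q n)).
{ induction n.
  - unfold P, Q. change (RtoC 1 = (1, - 0)). unfold RtoC. f_equal. ring.
  - change (Cmult (x * s, - y * s) (pow_n ((x * s, - y * s) : C) n) = (P (S n), - Q (S n))).
    rewrite IHn. unfold P, Q. rewrite Hz. apply injective_projections; simpl; unfold Re, Im; ring. }
assert (HPQ : forall n, P (S n) = x * s * P n - y * s * Q n /\ Q (S n) = x * s * Q n + y * s * P n).
{ intros n. unfold P, Q. rewrite Hz. split; simpl; unfold Re, Im; ring. }
assert (P0 : P O = 1) by reflexivity. assert (Q0 : Q O = 0) by reflexivity.
(* [P] and [Q] belong to the powers of [s (x + i y)], so the recurrence is used in scaled form, with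
   coefficients [a s] and [b s^2]. *)
assert (E : forall n, v n * s ^ n = 2 * (p * P n - q * Q n) /\
                      v (S n) * s ^ S n = 2 * (p * P (S n) - q * Q (S n))).
{ induction n as [|n [I0 I1]].
  - destruct (HPQ O) as [-> ->]. rewrite P0, Q0. split; unfold q, p; simpl; field; lra.
  - split; auto. specialize (Hv n).
    replace (v (S (S n)) * s ^ S (S n))
      with (- a * s * (v (S n) * s ^ S n) - b * s ^ 2 * (v n * s ^ n)).
    2:{ replace (v (S (S n))) with (- a * v (S n) - b * v n) by lra. simpl. ring. }
    rewrite I0, I1, Ha, Hb.
    destruct (HPQ (S n)) as [-> ->]. destruct (HPQ n) as [-> ->]. ring. }
set (SP := Series (fun n => e n * P n)). set (SQ := Series (fun n => e n * Q n)).
replace (Series (fun n => e n * Re (pow_n ((x * s, - y * s) : C) n))) with SP.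
2:{ apply Series_ext. intros n. now rewrite Hconj. }
replace (Series (fun n => e n * Im (pow_n ((x * s, - y * s) : C) n))) with (- SQ).
2:{ unfold SQ. rewrite <- Series_opp. apply Series_ext. intros n. rewrite Hconj. simpl. ring. }
change (Series (fun n => e n * Re (pow_n z n))) with SP.
change (Series (fun n => e n * Im (pow_n z n))) with SQ.
assert (Hft : f t = 2 * (p * SP - q * SQ)).
{ rewrite <- (is_series_unique _ _ (Hs t Ht)).
  assert (Hm : forall n, Rabs (P n) <= Cmod z ^ n /\ Rabs (Q n) <= Cmod z ^ n).
  { assert (Hm : forall n, Cmod (pow_n z n) <= Cmod z ^ n).
    { induction n.
      - change (Cmod 1 <= 1). rewrite Cmod_1. lra.
      - rewrite Hz, Cmod_mult. simpl. apply Rmult_le_compat_l; auto. apply Cmod_ge_0. }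
    intros n. assert (H := Rmax_Cmod (pow_n z n)). specialize (Hm n).
    split; apply Rle_trans with (2 := Hm); apply Rle_trans with (2 := H); [apply Rmax_l | apply Rmax_r]. }
  assert (AP := Series_correct _ (ex_series_KS_coef P (Cmod z) (fun n => proj1 (Hm n)))).
  assert (AQ := Series_correct _ (ex_series_KS_coef Q (Cmod z) (fun n => proj2 (Hm n)))).
  assert (A := is_series_minus _ _ _ _ (is_series_scal (2 * p) _ _ AP) (is_series_scal (2 * q) _ _ AQ)).
  fold SP SQ in A. apply is_series_unique.
  replace (2 * (p * SP - q * SQ)) with (2 * p * SP - 2 * q * SQ) by ring.
  eapply is_series_ext; [|exact A]. intros n.
  change (2 * p * (e n * P n) - 2 * q * (e n * Q n) = e n * (v n * s ^ n)).
  rewrite (proj1 (E n)). ring. }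
rewrite Hft. apply injective_projections; simpl; ring.
Qed.

End KilbasSaigo.

Theorem mainTheorem7 (alpha gamma a b : R) (fn : nat -> R) (f : R -> R) :
  0 < alpha < 1 -> 0 < alpha + gamma -> 0 < a -> 0 < b ->
  (* f is of the form sum_n f_n t^((alpha+gamma) n) for t > 0 *)
  (forall t, 0 < t ->
     is_series (fun n => fn n * Rpower t ((alpha + gamma) * INR n)) (f t)) ->
  (* f solves (D^(alpha,gamma))^2 f + a D^(alpha,gamma) f + b f = 0 on t > 0 *)
  (exists g1 g2 : R -> R,
     stretched_deriv alpha gamma f g1 /\
     stretched_deriv alpha gamma g1 g2 /\
     forall t, 0 < t -> g2 t + a * g1 t + b * f t = 0) ->
  let m := 1 + gamma / alpha in
  let l := gamma / alpha in
  (a ^ 2 / 4 > b ->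
     let eta1 := a / 2 - sqrt (a ^ 2 / 4 - b) in
     let eta2 := a / 2 + sqrt (a ^ 2 / 4 - b) in
     exists K1 K2 : R, forall t, 0 < t ->
       f t = K1 * KS_E alpha m l (- eta1 * Rpower t (alpha + gamma))
           + K2 * KS_E alpha m l (- eta2 * Rpower t (alpha + gamma))) /\
  (a ^ 2 / 4 < b ->
     (* sqrt(a^2/4 - b) = i sqrt(b - a^2/4) *)
     let eta1 : C := (a / 2, - sqrt (b - a ^ 2 / 4)) in
     let eta2 : C := (a / 2, sqrt (b - a ^ 2 / 4)) in
     exists K1 K2 : C, K1 = Cconj K2 /\ forall t, 0 < t ->
       RtoC (f t) =
         Cplus (Cmult K1 (KS_EC alpha m l (Cmult (Copp eta1) (RtoC (Rpower t (alpha + gamma))))))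
               (Cmult K2 (KS_EC alpha m l (Cmult (Copp eta2) (RtoC (Rpower t (alpha + gamma))))))) /\
  (b = a ^ 2 / 4 ->
     exists K1' K2' : R, forall t, 0 < t ->
       f t = K1' * KS_E alpha m l (- (a / 2) * Rpower t (alpha + gamma))
           + K2' * Rpower t (alpha + gamma)
                 * KS_E1 alpha m l (- (a / 2) * Rpower t (alpha + gamma))).
Proof.
intros Halpha Hgamma Ha Hb Hf Hsol m l. split; [|split].
- intros Hab eta1 eta2.
  set (r := sqrt (a ^ 2 / 4 - b)).
  assert (Hr : 0 < r) by (apply sqrt_lt_R0; lra).
  assert (Hr2 : r * r = a ^ 2 / 4 - b) by (apply sqrt_sqrt; lra).
  apply (KS_solution_distinct_roots alpha gamma Halpha Hgamma a b fn f Hf Hsol);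
    unfold eta1, eta2; fold r.
  + lra.
  + replace b with (a ^ 2 / 4 - r * r) by lra. field.
  + replace b with (a ^ 2 / 4 - r * r) by lra. field.
- intros Hab eta1 eta2.
  set (r := sqrt (b - a ^ 2 / 4)) in *.
  assert (Hr : 0 < r) by (apply sqrt_lt_R0; lra).
  assert (Hr2 : r * r = b - a ^ 2 / 4) by (apply sqrt_sqrt; lra).
  (* The characteristic roots are the negatives of [eta1] and [eta2]; as [eta1] has imaginary part
     [- r], its root comes first, with [+ r]. *)
  destruct (KS_solution_complex_roots alpha gamma Halpha Hgamma a b fn f Hf Hsol (- (a / 2)) r)
    as (K1 & K2 & HK & H).
  + lra.
  + lra.
  + replace b with (a ^ 2 / 4 + r * r) by lra. field.
  + exists K1, K2. split; auto. intros t Ht. rewrite (H t Ht). unfold m, l.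
    f_equal; f_equal; f_equal; unfold eta1, eta2; apply injective_projections; simpl; ring.
- intros Hab.
  apply (KS_solution_double_root alpha gamma Halpha Hgamma a b fn f Hf Hsol (- (a / 2))).
  + lra.
  + lra.
  + rewrite Hab. field.
Qed.
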